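(* Let $r>1$ be an integer. There exists a constant $A_r>0$ depending only on $r$ such that for every $\beta>0$ there exists $C>0$ such that for $p=p(n)\ge\frac Cn$, with high probability $G(n,p)\to_r\mathcal C$, where $\mathcal C=\{C_t\mid A_r\log n\le t\le(\lambda^*-\beta)n,\ t\text{ is even}\}$ and $\lambda^*=\lambda^*(r)$. In particular, with high probability $G(n,p)\to_rC_{\lfloor(\lambda^*-\beta)n\rfloor_{even}}$.
   Context: $G(n,p)$ is the binomial random graph on $\{1,\dots,n\}$ with each pair an edge independently with probability $p$. ''With high probability'' means with probability tending to $1$ as $n\to\infty$. $C_t$ and $P_t$ are the cycle and path of length $t$ (with $t$ edges), non-integer path lengths being rounded down; $\log$ is the natural logarithm. $\lfloor\ell\rfloor_{even}$ is the largest even integer $m\le\ell$. For graphs $G,H$, $G\to_rH$ means that every $r$-coloring of the edges of $G$ contains a monochromatic copy of $H$. For a family $\mathcal H$ of graphs, $G\to_r\mathcal H$ means that for every $r$-coloring of the edges of $G$ there exists a color $i$ such that there is a monochromatic copy of every $H\in\mathcal H$ in color $i$. $\lambda^*=\lambda^*(r)$ is the supremum, over all $\varepsilon>0$, of the numbers $\lambda$ for which there exists $k_0$ such that for all $k\ge k_0$ every graph $G$ on $k$ vertices with at least $(1-\varepsilon)\binom k2$ edges satisfies $G\to_rP_{\lambda k}$. The number $\beta$ in the ''in particular'' part is understood to be small enough that the cycle length is meaningful ($\beta<\lambda^*$). *)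

(* Defs.v *)
From HB Require Import structures.
From mathcomp Require Import all_boot all_order all_algebra.
From mathcomp Require Import all_classical all_reals all_analysis.
Set Implicit Arguments.
Unset Strict Implicit.
Unset Printing Implicit Defensive.
Import Order.TTheory GRing.Theory Num.Theory.
Import numFieldNormedType.Exports.
Local Open Scope ring_scope.

Record sgraph (V : finType) := SGraph {
  edges : {set {set V}};
  edges_card2 : [forall e in edges, #|e| == 2]
}.

HB.instance Definition _ (V : finType) := [isSub for @edges V].
HB.instance Definition _ (V : finType) := [Finite of sgraph V by <:].

Lemma rel_edges_card2 (V : finType) (e : rel V) :
  [forall a in [set [set x; y] | x in V, y in V & (x != y) && e x y]%SET,
     #|(a : {set V})| == 2].
Proof.
apply/forall_inP => a /imset2P[x y _]; rewrite inE => /and3P[_ xy _] ->.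
by rewrite cards2 xy.
Qed.

(* The simple graph underlying a relation: orientation and loops are dropped *)
Definition sgraph_of_rel (V : finType) (e : rel V) : sgraph V :=
  SGraph (rel_edges_card2 e).

Definition path_graph (t : nat) : sgraph 'I_t.+1 :=
  sgraph_of_rel (fun x y : 'I_t.+1 => y == x.+1 :> nat).

(* This is the cycle with t edges only for 3 <= t: for t = 2 it is a single
   edge, and it has no edges for t <= 1. *)
Definition cycle_graph (t : nat) : sgraph 'I_t :=
  sgraph_of_rel (fun x y : 'I_t => y == ordS x).

(* A coloring is defined on all sets of vertices, but only its values on the
   edges of G matter; copies are not required to be induced. *)
Definition mono_copy (r : nat) (V W : finType) (G : sgraph V)
    (c : {set V} -> 'I_r) (i : 'I_r) (H : sgraph W) : Prop :=
  exists2 f : W -> V, injective f &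
    forall e : {set W}, e \in edges H ->
      f @: e \in edges G /\ c (f @: e) = i.

Definition arrows (r : nat) (V W : finType) (G : sgraph V) (H : sgraph W) :
    Prop :=
  forall c : {set V} -> 'I_r, exists i : 'I_r, mono_copy G c i H.

Definition some_sgraph : Type := {W : finType & sgraph W}.

Definition arrows_family (r : nat) (V : finType) (G : sgraph V)
    (F : some_sgraph -> Prop) : Prop :=
  forall c : {set V} -> 'I_r, exists i : 'I_r,
    forall H : some_sgraph, F H -> mono_copy G c i (projT2 H).

Definition lambda_star (R : realType) (r : nat) : R :=
  sup [set lambda : R | 0 <= lambda /\
    exists2 eps : R, 0 < eps & exists k0 : nat,
      forall k : nat, (k0 <= k)%N -> forall G : sgraph 'I_k,
        (1 - eps) * 'C(k, 2)%:R <= #|edges G|%:R ->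
        arrows r G (path_graph (Num.truncn (lambda * k%:R)))]%classic.

Definition even_cycles (R : realType) (a b : R) (H : some_sgraph) : Prop :=
  exists2 t : nat, [/\ a <= t%:R, t%:R <= b & ~~ odd t] &
    H = existT sgraph ('I_t : finType) (cycle_graph t).

(* Only meaningful for 0 <= x *)
Definition floor_even (R : realType) (x : R) : nat :=
  \max_(m < (Num.truncn x).+1 | ~~ odd m) m.

Definition gnp_weight (R : realType) (n : nat) (p : R) (G : sgraph 'I_n) : R :=
  \prod_(e : {set 'I_n} | #|e| == 2) (if e \in edges G then p else 1 - p).

Definition gnp_prob (R : realType) (n : nat) (p : R)
    (E : set (sgraph 'I_n)) : R :=
  \sum_(G : sgraph 'I_n | G \in E) gnp_weight p G.

Definition gnp_whp (R : realType) (p : nat -> R)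
    (E : forall n : nat, set (sgraph 'I_n)) : Prop :=
  ((fun n : nat => gnp_prob (p n) (E n)) @ \oo --> (1 : R))%classic.

(* Main.v *)
(** Call two vertex sets k-joined in a color if any two subsets of them of size
    at least k span an edge of that color. With high probability G(n, C/n) has
    an edge between any two disjoint sets of size n/H; nothing else about the
    random graph is used.

    Densities play no role, so a qualitative regularity lemma suffices. Call a
    pair of parts of an equipartition bad if in every color it fails to be
    k-joined, k being a small fraction of the part size. Refining along the
    holes of the bad pairs increases the number of triples (x, y, color) such
    that there is no edge of that color between the parts of x and y by a
    constant proportion of n^2, so after boundedly many refinements few bad
    pairs remain. By the definition of lambda^*, the reduced graph on K parts
    then has a path of about lambda^* K parts, consecutive ones being k-joined
    in one color.

    Run depth-first search along the closed walk of parts that goes down this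
    path on one half of each part and comes back on the other half: it yields a
    monochromatic path that winds around and covers almost everything. Inside
    the first two parts, an expander hosts two disjoint trees of logarithmic
    depth with a common root and at least k leaves each; one set of leaves is
    pushed further, through b parts. Leaves see almost all of the next part, so
    the tree branches close a segment of the winding path to a cycle, and b
    adjusts its length modulo the period of the walk. *)

Require Import Defs.
From mathcomp Require Import all_boot zify.
Set Implicit Arguments.
Unset Strict Implicit.
Unset Printing Implicit Defensive.

(** * Joined pairs *)

Section Joined.
Local Open Scope nat_scope.
Variable V : finType.
Implicit Types (e : rel V) (A B X Y Z : {set V}).

Definition noedge e A B := [forall x in A, forall y in B, ~~ e x y].

Lemma noedgeP e A B :
  reflect (forall x y, x \in A -> y \in B -> ~~ e x y) (noedge e A B).
Proof.
apply: (iffP forall_inP) => [h x y /h/forall_inP|h x xA]; first exact.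
by apply/forall_inP => y; exact: h.
Qed.

Lemma noedgeS e A B A' B' :
  A' \subset A -> B' \subset B -> noedge e A B -> noedge e A' B'.
Proof.
move=> /subsetP sA /subsetP sB /noedgeP h.
by apply/noedgeP => x y /sA xA /sB; exact: h.
Qed.

Definition joined e k X Y : Prop := forall A B : {set V},
  A \subset X -> B \subset Y -> k <= #|A| -> k <= #|B| -> ~~ noedge e A B.

Lemma joinedS e k X Y X' Y' :
  X' \subset X -> Y' \subset Y -> joined e k X Y -> joined e k X' Y'.
Proof.
move=> sX sY h A B sA sB; apply: h; first exact: fintype.subset_trans sA sX.
exact: fintype.subset_trans sB sY.
Qed.

Lemma joined_sym e k X Y : symmetric e -> joined e k X Y -> joined e k Y X.
Proof.
move=> se h A B sA sB kA kB; apply: contra (h _ _ sB sA kB kA).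
by move=> /noedgeP n; apply/noedgeP => x y xB yA; rewrite se n.
Qed.

Definition nbhd e A := [set y | [exists x in A, e x y]].

Lemma nbhdP e A y :
  reflect (exists2 x, x \in A & e x y) (y \in nbhd e A).
Proof. by rewrite inE; exact: exists_inP. Qed.

Lemma joined_nbhd e k X Y A :
  joined e k X Y -> A \subset X -> k <= #|A| -> #|Y :\: nbhd e A| < k.
Proof.
move=> h sA kA; rewrite ltnNge; apply/negP => kB.
have /negP := h A _ sA (subsetDl Y (nbhd e A)) kA kB; apply.
apply/noedgeP => x y xA; rewrite inE => /andP[/negP yN _].
by apply/negP => exy; apply: yN; apply/nbhdP; exists x.
Qed.

Lemma cardsU_le A B : #|A :|: B| <= #|A| + #|B|.
Proof. exact: leq_card_setU. Qed.

Lemma subset_of_card A m : m <= #|A| ->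
  exists2 B : {set V}, B \subset A & #|B| = m.
Proof.
move=> mA; exists [set x in take m (enum A)].
  by apply/subsetP => x; rewrite inE => /mem_take; rewrite mem_enum.
rewrite cardsE (card_uniqP (take_uniq m (enum_uniq A))).
by rewrite size_takel // -cardE.
Qed.

End Joined.

(** * Winding paths by depth-first search *)

Section Winding.
Local Open Scope nat_scope.
Variables (V : finType) (e : rel V) (k L w : nat) (W : nat -> {set V}).
Hypothesis L_gt0 : 0 < L.
Hypothesis W_card : forall a, a < L -> #|W a| = w.
Hypothesis W_disj : forall a b x, a < L -> b < L -> x \in W a -> x \in W b ->
  a = b.
Hypothesis W_joined : forall a, a < L -> joined e k (W a) (W (a.+1 %% L)).

(* [q] is a stack: its head is the last vertex of the path. *)
Fixpoint winding (q : seq V) : bool :=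
  if q is v :: q' then
    [&& v \in W (size q' %% L), (if q' is u :: _ then e u v else true)
      & winding q']
  else true.

Lemma winding_mem x0 q i : winding q -> i < size q ->
  nth x0 (rev q) i \in W (i %% L).
Proof.
elim: q => //= v q IH /and3P[vW _ wq]; rewrite ltnS rev_cons nth_rcons size_rev.
by rewrite leq_eqVlt => /predU1P[->|iq]; rewrite ?ltnn ?eqxx // iq IH.
Qed.

Lemma winding_edge x0 q i : winding q -> i.+1 < size q ->
  e (nth x0 (rev q) i) (nth x0 (rev q) i.+1).
Proof.
elim: q => //= v q IH /and3P[_ euv wq]; rewrite ltnS rev_cons !nth_rcons size_rev.
rewrite leq_eqVlt => /predU1P[iq|iq]; last first.
  by rewrite iq orbT IH.
rewrite -iq ltnn eqxx /=; case: q iq euv {IH wq} => //= u q [->].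
by rewrite rev_cons nth_rcons size_rev ltnn eqxx.
Qed.

(** Since the cells are disjoint, a vertex of cell [b] sits at a position congruent to [b] modulo
    [L]. *)
Lemma winding_card q b : winding q -> b < L ->
  #|[set x in q] :&: W b| <= (size q %/ L).+1.
Proof.
move=> wq bL; case: q wq => [|x0 q] wq.
  by rewrite (_ : _ :&: _ = set0) ?cards0 //; apply/setP => x; rewrite !inE.
move: (x0 :: q) wq => {}q wq.
pose f (i : 'I_(size q %/ L).+1) := nth x0 (rev q) (i * L + b).
rewrite -[X in _ <= X]card_ord -cardsT.
apply: leq_trans (leq_imset_card f _).
apply/subset_leq_card/subsetP => x; rewrite !inE => /andP[xq xW].
have iq : index x (rev q) < size q by rewrite -size_rev index_mem mem_rev.
have xE : nth x0 (rev q) (index x (rev q)) = x by rewrite nth_index ?mem_rev.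
have := winding_mem x0 wq iq; rewrite xE => xW'.
have bE := W_disj (ltn_pmod _ L_gt0) bL xW' xW.
have dL : index x (rev q) %/ L < (size q %/ L).+1.
  by rewrite ltnS leq_div2r // ltnW.
apply/imsetP; exists (Ordinal dL) => //.
by rewrite /f /= -bE -divn_eq xE.
Qed.

(* [D] is the set of dead vertices. A vertex dies when it has no neighbor left
   in the next cell, so a cell with [k] dead vertices forces the path to have
   filled all but [2 k] vertices of the next one. *)
Lemma winding_search m q (D : {set V}) :
  (#|V| + #|V| < m + (#|D| + #|D| + size q)) ->
  winding q -> uniq q -> {in q, forall x, x \notin D} ->
  (forall a, a < L ->
     noedge e (D :&: W a) (W (a.+1 %% L) :\: ([set x in q] :|: D))) ->
  (forall a, a < L -> #|D :&: W a| < k) ->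
  exists p, [/\ winding p, uniq p & L * (w - (k + k)) <= size p].
Proof.
(* The potential [2|D| + size q] gains one when a vertex is pushed and also when the head dies. As
   path and dead set are disjoint it never exceeds [2|V|], so [m] bounds the remaining steps. *)
elim: m q D => [|m IH] q D hm wq uq qD nD kD.
  have : #|[set x in q] :|: D| <= #|V| by rewrite max_card.
  rewrite cardsU disjoint_setI0 ?cards0 ?subn0; last first.
    by apply/pred0P => x /=; rewrite inE; apply/andP => -[/qD/negP].
  by rewrite cardsE (card_uniqP uq); lia.
case: (leqP (L * (w - (k + k))) (size q)) => [|small]; first by exists q.
have bL : size q %% L < L by rewrite ltn_pmod.
have push u : u \in W (size q %% L) -> u \notin q -> u \notin D ->
    (if q is v :: _ then e v u else true) ->
    exists p, [/\ winding p, uniq p & L * (w - (k + k)) <= size p].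
  move=> uW uq' uD equ; apply: (IH (u :: q) D).
  - by move: hm; clear=> /=; lia.
  - by rewrite /= uW equ.
  - by rewrite /= uq'.
  - by move=> x; rewrite inE => /predU1P[->//|/qD].
  - move=> a aL; apply: noedgeS (nD a aL) => //; apply/setDS/setSU.
    by apply/subsetP => x; rewrite !inE => ->; rewrite orbT.
  - exact: kD.
(* While the path is short, at most [w - 2k] of its vertices lie in the next cell; the dead vertices
   and any set of fewer than [k] others leave room there. *)
have free (A : {set V}) : #|A| < k -> #|[set x in q] :&: W (size q %% L)| +
    #|A| + #|D :&: W (size q %% L)| < w.
  move=> Ak; have := winding_card wq bL; have := kD _ bL.
  have : size q %/ L < w - (k + k) by rewrite ltn_divLR // mulnC.
  lia.
case: q => [|v q] in hm wq uq qD nD small push bL free *.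
  have : 0 < #|W 0 :\: D|.
    have := kD 0 L_gt0; have := cardsID D (W 0); rewrite W_card // setIC.
    by move: small; rewrite muln_gt0; lia.
  case/card_gt0P => u; rewrite inE => /andP[uD uW].
  by apply: (push u) => //=; rewrite mod0n.
have aL : size q %% L < L by rewrite ltn_pmod.
have aS : (size q %% L).+1 %% L = size (v :: q) %% L.
  by rewrite -addn1 modnDml addn1.
case: (pickP [pred u | [&& u \in W (size (v :: q) %% L), u \notin v :: q,
   u \notin D & e v u]]) => [u /and4P[]|none]; first exact: push.
move: (wq) => /= /and3P[vW _ wq'].
have vD : v \notin D by apply: qD; rewrite mem_head.
(* Killing the head [v] only moves it from the path to [D], so the free vertices stay the same; by
   [none], [v] has no free neighbor in the next cell. *)
have unionE : [set x in q] :|: (v |: D) = [set x in v :: q] :|: D.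
  by apply/setP => x; rewrite !inE; case: (x == v); case: (x \in q).
have nD' a : a < L -> noedge e ((v |: D) :&: W a)
     (W (a.+1 %% L) :\: ([set x in q] :|: (v |: D))).
  move=> aL'; apply/noedgeP => x y; rewrite unionE => xA yB.
  move: xA; rewrite inE in_setU1 => /andP[/predU1P[->|xD] xW]; last first.
    by move/noedgeP: (nD a aL') => /(_ x y); apply; rewrite // inE xD.
  have aE := W_disj aL aL' vW xW.
  move: yB; rewrite -aE aS in_setD in_setU !negb_or inE => /andP[/andP[yq yD] yW].
  by have := none y; rewrite /= yW yq yD /= => ->.
case: (ltnP #|(v |: D) :&: W (size q %% L)| k) => [lt|ge].
  apply: (IH q (v |: D)) => //.
  - by rewrite cardsU1 vD /=; move: hm => /=; lia.
  - by move: uq => /= /andP[].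
  - move=> x xq; rewrite in_setU1 negb_or qD ?inE ?xq ?orbT ?andbT //.
    by apply: contraNneq (andP uq).1 => <-.
  - move=> a aL'; have [->//|ne] := eqVneq a (size q %% L).
    rewrite (_ : _ :&: _ = D :&: W a) ?kD //; apply/setP => x.
    rewrite !inE; have [->|//] := eqVneq x v; rewrite (negbTE vD) /=.
    by apply/negbTE/negP => vW'; move/eqP: ne; apply; exact: W_disj vW' vW.
(* Otherwise [k] dead vertices of this cell see all but fewer than [k] vertices of the next one, and
   only vertices that are dead or on the path: the next cell would be full, against [free]. *)
have := joined_nbhd (W_joined aL) (subsetIr _ _) ge.
rewrite aS; set N := nbhd _ _; set b := _ %% L => Nk.
have := free _ Nk; rewrite ltnNge => /negP[].
rewrite -(W_card bL) -/b.
apply: leq_trans (_ : #|([set x in v :: q] :&: W b) :|: (W b :\: N)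
   :|: (D :&: W b)| <= _).
  apply/subset_leq_card/subsetP => y yW.
  rewrite !(in_setU, in_setI, in_setD) yW !andbT inE.
  case yq: (y \in v :: q) => //=; case yD: (y \in D); rewrite ?orbT ?orbF //.
  apply/negP => /nbhdP[x xA exy]; move/noedgeP: (nD' _ aL) => /(_ x y xA).
  by rewrite exy unionE aS in_setD in_setU inE yq yD /= => /(_ yW).
by rewrite (leq_trans (cardsU_le _ _)) // leq_add2r cardsU_le.
Qed.

Lemma winding_path : 0 < k ->
  exists p, [/\ winding p, uniq p & L * (w - (k + k)) <= size p].
Proof.
move=> k_gt0; apply: (@winding_search (#|V| + #|V|).+1 [::] set0) => //.
- by rewrite cards0 !addn0 ltnSn.
- move=> a _; apply/noedgeP => x y; rewrite !inE //.
- by move=> a _; rewrite set0I cards0.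
Qed.

End Winding.

(** * Expanders and trees *)

Section Expander.
Variables (V : finType) (e : rel V).
Implicit Types A S T U Z : {set V}.

Lemma nbhdU A (B : {set V}) : nbhd e (A :|: B) = nbhd e A :|: nbhd e B.
Proof.
apply/setP => y; rewrite in_setU; apply/nbhdP/orP.
  move=> [x]; rewrite inE => /orP[] xA exy; [left|right];
    by apply/nbhdP; exists x.
by case=> /nbhdP[x xA exy]; exists x; rewrite // inE xA ?orbT.
Qed.

(** Let [F] be a largest set of fewer than [K] vertices with at most [d|F|] outside neighbors in
    [Z], and delete it. A small set [A] that fails in the rest could be added to [F]; by maximality
    the union has between [K] and [2K] vertices, against the expansion assumed for such sets. *)
Lemma expander_core K d Z : 0 < K ->
  (forall A, A \subset Z -> K <= #|A| <= K + K ->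
     d.+1 * (K + K) < #|nbhd e A :&: Z|) ->
  exists2 Z' : {set V}, Z' \subset Z /\ #|Z :\: Z'| < K &
    forall A, A \subset Z' -> #|A| <= K -> d * #|A| <= #|nbhd e A :&: Z'|.
Proof.
move=> K_gt0 hZ.
pose P A := [&& A \subset Z, #|A| < K & #|(nbhd e A :&: Z) :\: A| <= d * #|A|].
have P0 : P set0.
  rewrite /P sub0set cards0 K_gt0 muln0 leqn0 cards_eq0 setD0 -subset0 /=.
  by apply/subsetP => y; rewrite in_setI => /andP[/nbhdP[x]]; rewrite inE.
case: (arg_maxnP (fun A : {set V} => #|A|) P0) => F /and3P[FZ FK FN] Fmax.
exists (Z :\: F).
  split; first exact: subsetDl.
  apply: leq_ltn_trans FK; apply/subset_leq_card/subsetP => x.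
  by rewrite !inE => /andP[+ xZ]; rewrite xZ andbT negbK.
move=> A AZ AK; rewrite leqNgt; apply/negP => small.
have dAF : F :&: A = set0.
  apply/setP => x; rewrite !inE; apply/negbTE/negP => /andP[xF xA].
  by move/subsetP: AZ => /(_ x xA); rewrite inE xF.
have cAF : #|F :|: A| = #|F| + #|A| by rewrite cardsU dAF cards0 subn0.
have A_gt0 : 0 < #|A| by move: small; case: #|A|; rewrite ?muln0.
have sFA : F :|: A \subset Z.
  by rewrite subUset FZ (fintype.subset_trans AZ) ?subsetDl.
have step : #|(nbhd e (F :|: A) :&: Z) :\: (F :|: A)| <= d * #|F :|: A|.
  rewrite cAF mulnDr.
  apply: leq_trans (leq_add FN (ltnW small)).
  apply: leq_trans (cardsU_le _ _); apply/subset_leq_card/subsetP => y.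
  rewrite nbhdU !(in_setD, in_setI, in_setU) negb_or.
  by case: (y \in F); case: (y \in A); case: (_ \in nbhd e F) => //= ->.
case: (ltnP #|F :|: A| K) => [lt|ge].
  by have := Fmax (F :|: A); rewrite /P sFA lt step /= cAF => /(_ isT); lia.
have le2 : #|F :|: A| <= K + K by rewrite cAF; lia.
have := hZ _ sFA; rewrite ge le2 => /(_ isT); apply/negP; rewrite -leqNgt.
have le : d.+1 * #|F :|: A| <= d.+1 * (K + K) by rewrite leq_mul2l le2 orbT.
apply: leq_trans le; rewrite mulSn addnC.
apply: leq_trans (leq_add step (leqnn #|F :|: A|)).
apply: leq_trans (cardsU_le _ _).
apply/subset_leq_card/subsetP => y; rewrite !(in_setD, in_setI, in_setU).
by case/andP=> -> ->; case: (_ \in F); case: (_ \in A).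
Qed.

(** Stands for a tree of depth [m] with root [x] and leaves [S]. Only branches are recorded, because
    a cycle uses a single one; [p] omits the root, so [U] need not contain it. *)
Definition reach x S (U : {set V}) m := forall v, v \in S -> exists p : seq V,
  [/\ path e x p, last x p = v, size p = m, uniq p & {subset p <= U}].

Lemma reach_step x S S' U m : x \notin S' -> S' \subset nbhd e S ->
  [disjoint S' & U] -> reach x S U m -> reach x S' (U :|: S') m.+1.
Proof.
move=> xS' /subsetP sS' dS' hS v vS'.
have /nbhdP[u /hS[p [ep lp sp up pU]] euv] := sS' _ vS'.
exists (rcons p v); split; rewrite ?last_rcons ?size_rcons ?sp //.
- by rewrite rcons_path ep lp.
- rewrite rcons_uniq up andbT; apply/negP => /pU vU.
  by move/disjoint_setI0/setP: dS' => /(_ v); rewrite !inE vU vS'.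
- by move=> y; rewrite mem_rcons !inE => /predU1P[->|/pU ->]; rewrite ?vS' ?orbT.
Qed.

(* Both trees double at every level; an expansion by [8] leaves room to avoid
   the at most [4 * 2 ^ i] vertices used so far and the other new level. *)
Lemma two_trees K Z x i : x \in Z -> 2 ^ i <= K + K ->
  (forall A, A \subset Z -> #|A| <= K -> 8 * #|A| <= #|nbhd e A :&: Z|) ->
  exists S T US UT : {set V},
    [/\ [/\ #|S| = 2 ^ i, #|T| = 2 ^ i, S \subset Z & T \subset Z],
        [/\ US \subset Z, UT \subset Z, [disjoint US & UT],
            x \notin US & x \notin UT]
      & [/\ reach x S US i, reach x T UT i & #|US| + #|UT| + 4 <= 4 * 2 ^ i]].
Proof.
move=> xZ; elim: i => [|i IH] hi hZ.
  exists [set x], [set x], set0, set0; split.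
  - by rewrite cards1 sub1set xZ.
  - by rewrite !sub0set !inE; split=> //; rewrite disjoints_subset sub0set.
  - rewrite cards0; split=> // v; rewrite inE => /eqP->; exists [::]; split=> //.
have hi' : 2 ^ i <= K by move: hi; rewrite expnS; lia.
have [|//|S [T [US [UT [[cS cT SZ TZ] [USZ UTZ dU xS xT] [rS rT cU]]]]]] := IH.
  by lia.
pose used := x |: (US :|: UT).
(* The levels [1] to [i] of both trees have [4 * 2 ^ i - 4] vertices, and the root adds one. *)
have cused : #|used| + 3 <= 4 * 2 ^ i.
  rewrite /used; apply: leq_trans cU.
  have := cardsU_le [set x] (US :|: UT); have := cardsU_le US UT.
  by rewrite cards1; lia.
have new (A B : {set V}) : A \subset Z -> #|A| = 2 ^ i -> #|B| <= 2 ^ i.+1 ->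
    exists A' : {set V}, [/\ A' \subset nbhd e A, A' \subset Z, #|A'| = 2 ^ i.+1,
      [disjoint A' & used] & [disjoint A' & B]].
  move=> AZ cA cB.
  have /subset_of_card[A' sA' cA'] :
      2 ^ i.+1 <= #|(nbhd e A :&: Z) :\: (used :|: B)|.
    have := hZ A AZ; rewrite cA => /(_ hi').
    have := cardsID (used :|: B) (nbhd e A :&: Z).
    have : #|nbhd e A :&: Z :&: (used :|: B)| <= #|used :|: B|.
      exact/subset_leq_card/subsetIr.
    have := cardsU_le used B.
    by move: cB cused; rewrite expnS; lia.
  move/subsetP: sA' => sA'; exists A'; split=> //.
  - by apply/subsetP => y /sA'; rewrite in_setD in_setI => /and3P[].
  - by apply/subsetP => y /sA'; rewrite in_setD in_setI => /and3P[].
  - rewrite disjoints_subset; apply/subsetP => y /sA'.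
    by rewrite in_setD in_setU negb_or in_setC => /andP[/andP[]].
  - rewrite disjoints_subset; apply/subsetP => y /sA'.
    by rewrite in_setD in_setU negb_or in_setC => /andP[/andP[]].
have [|S' [nS' S'Z cS' dS' _]] := new S set0 SZ cS; first by rewrite cards0.
have [|T' [nT' T'Z cT' dT' dTS]] := new T S' TZ cT; first by rewrite cS'.
have split_used (A : {set V}) : [disjoint A & used] ->
    [/\ x \notin A, [disjoint A & US] & [disjoint A & UT]].
  rewrite /used !disjoints_subset => /subsetP h; split.
  - by apply/negP => /h; rewrite !inE eqxx.
  - by apply/subsetP => y /h; rewrite !inE !negb_or => /and3P[].
  - by apply/subsetP => y /h; rewrite !inE !negb_or => /and3P[].
have [xS' dSS dST] := split_used _ dS'; have [xT' dTS' dTT] := split_used _ dT'.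
exists S', T', (US :|: S'), (UT :|: T'); split.
- by split.
- split; rewrite ?subUset ?USZ ?UTZ //.
  + rewrite -!setI_eq0 setIUl !setIUr !setU_eq0 -!andbA !setI_eq0.
    by rewrite dU dST (disjoint_sym US) dTS' (disjoint_sym S') dTS.
  + by rewrite in_setU negb_or xS.
  + by rewrite in_setU negb_or xT.
- split; [exact: reach_step nS' dSS rS|exact: reach_step nT' dTT rT|].
  have := cardsU_le US S'; have := cardsU_le UT T'.
  rewrite cS' cT' !expnS; move: cU; clear; move: (2 ^ i) => m.
  by lia.
Qed.

End Expander.

Section BipartiteTrees.
Variables (V : finType) (e : rel V) (k : nat) (Z0 Z1 : {set V}).
Hypotheses (e_sym : symmetric e) (k_gt0 : 0 < k).
Hypotheses (Z01 : [disjoint Z0 & Z1]) (joinedZ : joined e k Z0 Z1).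
Hypotheses (cZ0 : 37 * k <= #|Z0|) (cZ1 : 37 * k <= #|Z1|).

(** Keeping only the edges between the two sides makes the parity of the depth determine the side of
    a vertex. *)
Let bip : rel V := fun x y =>
  e x y && ((x \in Z0) && (y \in Z1) || (x \in Z1) && (y \in Z0)).

Let bip_path x p : x \in Z1 -> path bip x p ->
  last x p \in if odd (size p) then Z0 else Z1.
Proof.
move=> xZ; elim/last_ind: p => [//|p y IH].
rewrite rcons_path last_rcons size_rcons.
case/andP=> /IH; rewrite /bip /=.
have d z : z \in Z0 -> z \in Z1 -> false.
  by move=> z0 z1; move/disjoint_setI0/setP: Z01 => /(_ z); rewrite !inE z0 z1.
by case: (odd _) => /= h /andP[_ /orP[] /andP[h' //]];
  case/idP: (d _ h h') || case/idP: (d _ h' h).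
Qed.

(** A set of [2k] to [4k] vertices has [k] of them on one side, hence misses fewer than [k] vertices
    of the other and has more than [36k = 9 * 4k] neighbors. This is why the sides have [37k]
    vertices: [expander_core] applies with [d = 8] and leaves a host for [two_trees]. As [j] is
    even, the leaves are on the side of the root. *)
Lemma bipartite_trees j : ~~ odd j -> 2 ^ j <= 4 * k ->
  exists (x : V) (S T US UT : {set V}),
    [/\ [/\ #|S| = 2 ^ j, #|T| = 2 ^ j, S \subset Z1 & T \subset Z1],
        [/\ x \in Z1, US \subset Z0 :|: Z1, UT \subset Z0 :|: Z1,
            [disjoint US & UT] & (x \notin US) && (x \notin UT)]
      & reach e x S US j /\ reach e x T UT j].
Proof.
move=> oj hj.
have e_sub : subrel bip e by move=> x y /andP[].
have jZ10 := joined_sym e_sym joinedZ.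
have [|A AZ /andP[Ak _]|Z' [Z'Z Z'c] hZ'] :=
    @expander_core V bip (k + k) 8 (Z0 :|: Z1).
- by lia.
- have [kA|kA] := leqP k #|A :&: Z0|.
    have := joined_nbhd joinedZ (subsetIr A Z0) kA.
    have := cardsID (nbhd e (A :&: Z0)) Z1.
    suff: #|Z1 :&: nbhd e (A :&: Z0)| <= #|nbhd bip A :&: (Z0 :|: Z1)| by lia.
    apply/subset_leq_card/subsetP => y; rewrite !in_setI => /andP[yZ /nbhdP[z]].
    rewrite in_setI => /andP[zA zZ] ezy; rewrite in_setU yZ orbT andbT.
    by apply/nbhdP; exists z => //; rewrite /bip ezy zZ yZ.
  have {}kA : k <= #|A :&: Z1|.
    have : #|A| <= #|A :&: Z0| + #|A :&: Z1|.
      apply: leq_trans (cardsU_le _ _); apply/subset_leq_card/subsetP => y yA.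
      by move/subsetP: AZ => /(_ y yA); rewrite !inE yA.
    by lia.
  have := joined_nbhd jZ10 (subsetIr A Z1) kA.
  have := cardsID (nbhd e (A :&: Z1)) Z0.
  suff: #|Z0 :&: nbhd e (A :&: Z1)| <= #|nbhd bip A :&: (Z0 :|: Z1)| by lia.
  apply/subset_leq_card/subsetP => y; rewrite !in_setI => /andP[yZ /nbhdP[z]].
  rewrite in_setI => /andP[zA zZ] ezy; rewrite in_setU yZ andbT.
  by apply/nbhdP; exists z => //; rewrite /bip ezy zZ yZ orbT.
have /card_gt0P[x] : 0 < #|Z1 :&: Z'|.
  have := cardsID Z' Z1.
  have : #|Z1 :\: Z'| <= #|(Z0 :|: Z1) :\: Z'|.
    by apply/subset_leq_card/setSD/subsetUr.
  by lia.
rewrite inE => /andP[xZ1 xZ'].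
have [|S [T [US [UT [[cS cT _ _] [USZ UTZ dU xS xT] [rS rT _]]]]]] :=
    @two_trees V bip (k + k) Z' x j xZ' _ hZ'; first by lia.
have sub (A U : {set V}) : reach bip x A U j -> A \subset Z1 /\ reach e x A U j.
  move=> r; split.
    apply/subsetP => v /r[p [ep <- sp _ _]].
    by have := bip_path xZ1 ep; rewrite sp (negbTE oj).
  move=> v /r[p [ep lp sp up pU]]; exists p; split=> //.
  exact: sub_path ep.
have [SZ rS'] := sub _ _ rS; have [TZ rT'] := sub _ _ rT.
exists x, S, T, US, UT; split=> //; split=> //.
- exact: fintype.subset_trans USZ Z'Z.
- exact: fintype.subset_trans UTZ Z'Z.
- by rewrite xS.
Qed.

End BipartiteTrees.

(** * Even cycles along a path of parts *)

Section Slice.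
Variable V : finType.

(** Cutting along the enumeration of [A] turns disjoint index intervals into disjoint subsets of
    prescribed size. *)
Definition slice (A : {set V}) i m :=
  [set x in A | i <= index x (enum A) < i + m].

Lemma slice_sub A i m : slice A i m \subset A.
Proof. by apply/subsetP => x; rewrite inE => /andP[]. Qed.

Lemma card_slice (A : {set V}) i m : i + m <= #|A| -> #|slice A i m| = m.
Proof.
move=> im; case: m im => [_|m im].
  by apply/eqP; rewrite cards_eq0; apply/eqP/setP => x; rewrite !inE; lia.
have /card_gt0P[x0 _] : 0 < #|A| by lia.
have idx (h : 'I_m.+1) : i + h < size (enum A).
  by rewrite -cardE; have := ltn_ord h; lia.
pose f (h : 'I_m.+1) := nth x0 (enum A) (i + h).
have f_inj : injective f.
  move=> h1 h2 /eqP; rewrite /f nth_uniq ?enum_uniq // eqn_add2l => /eqP.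
  exact: ord_inj.
rewrite -[RHS]card_ord -cardsT -(card_imset _ f_inj); congr #|pred_of_set _|.
apply/setP => x; rewrite inE; apply/andP/imsetP => [[xA ix]|[h _ ->]].
  have hx : index x (enum A) - i < m.+1 by lia.
  exists (Ordinal hx); rewrite // /f /= subnKC ?nth_index ?mem_enum //; lia.
rewrite /f index_uniq ?enum_uniq // -mem_enum mem_nth //.
by have := ltn_ord h; split; lia.
Qed.

End Slice.

(** The interval from [k] to [4k] contains a power of four. *)
Lemma sandwich_pow2 k : 0 < k ->
  exists j, [/\ ~~ odd j, 1 < j & k <= 2 ^ j <= 4 * k].
Proof.
case: k => // k _; elim: k => [|k [j [oj j1 /andP[kj jk]]]]; first by exists 2.
case: (leqP k.+2 (2 ^ j)) => [kj'|jk']; first by exists j; split=> //; lia.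
by exists j.+2; rewrite negbK !expnS; split=> //; lia.
Qed.

Section Embedding.
Variables (V : finType) (e : rel V) (k N s : nat) (U : nat -> {set V}).
Hypotheses (e_sym : symmetric e) (k_gt0 : 0 < k) (N_gt0 : 0 < N).
Hypothesis U_card : forall a, a <= N -> #|U a| = s.
Hypothesis U_disj : forall a b x, a <= N -> b <= N -> x \in U a -> x \in U b ->
  a = b.
Hypothesis U_joined : forall a, a < N -> joined e k (U a) (U a.+1).
Hypothesis large : 50 * k <= s.

(** Each part is cut into two cells of size [w] for the winding path, [2k] vertices [Rs] for the
    pushed leaves and [37k] vertices [Z] for the trees. *)
Let w := (s - 39 * k)./2.
Let L := N + N.
Let Z a := slice (U a) (w + w + k + k) (37 * k).
Let Rs a := slice (U a) (w + w) (k + k).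
(* The closed walk of cells: down the path on the first slices, back on the
   second ones. *)
Let W c := if c <= N then slice (U c) 0 w else slice (U (L - c)) w w.

Let w_bound : w + w + 39 * k <= s. Proof. by rewrite /w; lia. Qed.

Let slice_disj a b i m i' m' x : a <= N -> b <= N ->
  x \in slice (U a) i m -> x \in slice (U b) i' m' ->
  a = b /\ (i < i' + m') && (i' < i + m).
Proof.
move=> aN bN; rewrite !inE => /andP[xa ix] /andP[xb ix'].
have ab := U_disj aN bN xa xb; split=> //.
by move: ix ix'; rewrite ab; lia.
Qed.

Let W_card c : c < L -> #|W c| = w.
Proof.
move=> cL; rewrite /W; case: leqP => cN; rewrite card_slice // U_card //.
- by have := w_bound; lia.
- by have := w_bound; lia.
- by move: cL cN; rewrite /L; lia.
Qed.

Let W_disj c c' x : c < L -> c' < L -> x \in W c -> x \in W c' -> c = c'.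
Proof.
move=> cL c'L; rewrite /W.
have h d : N < d -> L - d <= N by rewrite /L; lia.
case: leqP => cN; case: leqP => c'N => h1 h2.
- by have [] := slice_disj cN c'N h1 h2.
- by have [_] := slice_disj cN (h _ c'N) h1 h2; lia.
- by have [_] := slice_disj (h _ cN) c'N h1 h2; lia.
- by have [] := slice_disj (h _ cN) (h _ c'N) h1 h2; lia.
Qed.

Let U_joined' a b : a <= N -> b <= N -> (b == a.+1) || (a == b.+1) ->
  joined e k (U a) (U b).
Proof.
move=> aN bN /orP[] /eqP E; first by rewrite E; apply: U_joined; rewrite -E.
by rewrite E; apply: joined_sym e_sym _; apply: U_joined; rewrite -E.
Qed.

Let W_sub c : W c \subset U (if c <= N then c else L - c).
Proof. by rewrite /W; case: leqP => _; exact: slice_sub. Qed.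

Let W_joined c : c < L -> joined e k (W c) (W (c.+1 %% L)).
Proof.
move=> cL; apply: joinedS (W_sub c) (W_sub _) _.
have [E|E] := eqVneq c.+1 L.
  rewrite E modnn /=; apply: U_joined' => //.
    by move: cL; rewrite /L; case: (leqP c N); lia.
  by move: E; rewrite /L; case: (leqP c N); lia.
rewrite modn_small; last by lia.
apply: U_joined'; move: cL E; rewrite /L; case: (leqP c N);
  by case: (leqP c.+1 N); lia.
Qed.

(** The leaves move from part [1] to part [0] and then down the path of parts, so that after [b]
    steps they lie in a part adjacent to part [b], also for [b = 0]. Fewer than [k] of the [2k]
    vertices of [Rs b] are missed, so [k] leaves survive each step. *)
Let reach_chain x (T UT : {set V}) j b : b < N -> x \in Z 1 ->
  UT \subset Z 0 :|: Z 1 ->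
  x \notin UT -> T \subset Z 1 -> k <= #|T| -> reach e x T UT j ->
  exists T' : {set V},
    [/\ k <= #|T'|, T' \subset U (if b is b'.+1 then b' else 1)
      & reach e x T' (UT :|: \bigcup_(c < b) Rs c) (j + b)].
Proof.
move=> + xZ UTZ xUT TZ kT rT; elim: b => [|b IH] bN.
  exists T; split=> //; first exact: fintype.subset_trans TZ (slice_sub _ _ _).
  move=> v /rT[p [ep lp sp up pU]]; exists p; split; rewrite ?addn0 //.
  by move=> y /pU yU; rewrite inE yU.
have {IH}[T' [kT' T'U rT']] := IH (ltnW bN).
have jTR : joined e k (U (if b is b'.+1 then b' else 1)) (Rs b).
  apply: joinedS (fintype.subxx _) (slice_sub _ _ _) _.
  by apply: U_joined'; case: (b) bN => //=; lia.
have RsZ y c : c < N -> y \in Rs c -> y \notin Z 0 :|: Z 1.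
  move=> cN yR; apply/negP; rewrite in_setU => /orP[] yZ.
    by have [_] := slice_disj (ltnW cN) (leq0n N) yR yZ; clear; lia.
  by have [_] := slice_disj (ltnW cN) N_gt0 yR yZ; clear; lia.
exists (Rs b :&: nbhd e T'); split.
- have := joined_nbhd jTR T'U kT'; have := cardsID (nbhd e T') (Rs b).
  rewrite card_slice; first by lia.
  by rewrite U_card ?(ltnW (ltnW bN)) //; have := w_bound; lia.
- exact: fintype.subset_trans (subsetIl _ _) (slice_sub _ _ _).
have := @reach_step _ e x T' (Rs b :&: nbhd e T') _ _ _ (subsetIr _ _) _ rT'.
rewrite addnS => h v vT.
have [||p [ep lp sp up pU]] := h _ _ v vT.
- apply/negP; rewrite inE => /andP[xR _].
  by have := RsZ _ _ (ltnW bN) xR; rewrite in_setU xZ orbT.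
- rewrite disjoints_subset; apply/subsetP => y; rewrite in_setI => /andP[yR _].
  rewrite in_setC in_setU negb_or; apply/andP; split.
    by apply: contra (RsZ _ _ (ltnW bN) yR) => /(subsetP UTZ).
  apply/negP => /bigcupP[c _ yRc].
  have cN : c <= N.
    by apply: leq_trans (ltnW (ltn_ord c)) _; exact: ltnW (ltnW bN).
  have [] := slice_disj cN (ltnW (ltnW bN)) yRc yR.
  by have := ltn_ord c; move: (nat_of_ord c) => c'; clear; lia.
exists p; split=> // y /pU; rewrite big_ord_recr /= setUA !inE.
by case/orP=> [->//|/andP[-> _]]; rewrite orbT.
Qed.

(** The cycle runs from the root [x] along a branch to [S], by an edge to cell [0] of the winding
    path, along a segment of it to cell [b], by an edge to [T'] and back along a branch. The two
    trees are disjoint, and trees, pushed leaves and winding path use different slices. *)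
Lemma even_cycle_embedding t : ~~ odd t ->
  2 * trunc_log 2 #|V| + 2 <= t -> t <= N * (s - 50 * k) ->
  exists C : seq V, [/\ size C = t, uniq C & cycle e C].
Proof.
move=> ot tlow thigh.
have [j [oj j1 /andP[kj jk]]] := sandwich_pow2 k_gt0.
have Z_card a : a <= N -> #|Z a| = 37 * k.
  by move=> aN; rewrite card_slice // U_card //; have := w_bound; lia.
have dZ : [disjoint Z 0 & Z 1].
  rewrite -setI_eq0; apply/eqP/setP => y; rewrite in_setI in_set0.
  by apply/negP => /andP[y0 y1]; have [] := slice_disj (leq0n N) N_gt0 y0 y1.
have jZ : joined e k (Z 0) (Z 1).
  by apply: joinedS (slice_sub _ _ _) (slice_sub _ _ _) _; exact: U_joined.
have [||x [S [T [US [UT [[cS cT SZ TZ]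
    [xZ USZ UTZ dU /andP[xUS xUT]] [rS rT]]]]]]] :=
  @bipartite_trees V e k (Z 0) (Z 1) e_sym k_gt0 dZ jZ _ _ j oj jk.
- by rewrite Z_card.
- by rewrite Z_card.
have jlog : j <= trunc_log 2 #|V|.
  apply: trunc_log_max => //; apply: leq_trans jk _.
  have := U_card (leq0n N); have : #|U 0| <= #|V| by rewrite max_card.
  by move: large k_gt0; clear; lia.
pose h := (t - 2 * j - 2)./2.
have tE : t = 2 * j + 2 + 2 * h.
  by rewrite /h; move: ot tlow jlog; move: (trunc_log _ _) => l; clear; lia.
(* The branches will have [j] and [j + b] edges and the segment [d]; with two closing edges this
   makes [2j + 2 + 2(ND + b)], because [L = 2N]. *)
pose D := h %/ N; pose b := h %% N; pose d := L * D + b.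
have hE : h = N * D + b by rewrite mulnC; exact: divn_eq.
have bN : b < N by rewrite ltn_pmod.
have [|T' [kT' T'U rT']] := reach_chain bN xZ UTZ xUT TZ _ rT.
  by rewrite cT.
have L_gt0 : 0 < L by rewrite addn_gt0 N_gt0.
have [q [wq uq sq]] := winding_path L_gt0 W_card W_disj W_joined k_gt0.
pose p := rev q.
have sp : L * (w - (k + k)) <= size p by rewrite size_rev.
have up : uniq p by rewrite rev_uniq.
(* This fits [2k] segments, each shifted by one period, into the path. Of the [50k], [39k] lie
   outside the cells, [8k] are spent here and the rest absorbs rounding. *)
have D_bound : D + (k + k) <= w - (k + k).
  have : D <= (s - 50 * k)./2.
    have : N * (D + D) <= N * (s - 50 * k).
      by apply: leq_trans thigh; rewrite tE mulnDr hE; clear; lia.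
    by rewrite leq_mul2l; move: N_gt0; clear; lia.
  by rewrite /w; move: large k_gt0; clear; lia.
have pos_lt (i : 'I_(k + k)) : L * i + d < size p.
  apply: leq_trans sp; apply: leq_trans (leq_mul (leqnn L) D_bound).
  rewrite /d mulnDr.
  have : L * i.+1 <= L * (k + k) by rewrite leq_mul2l ltn_ord orbT.
  by rewrite mulnS /L; move: bN; clear; lia.
have bL : b < L by rewrite ltn_addr.
pose f1 (i : 'I_(k + k)) := nth x p (L * i).
pose f2 (i : 'I_(k + k)) := nth x p (L * i + d).
have pos_lt1 (i : 'I_(k + k)) : L * i < size p.
  by apply: leq_ltn_trans (pos_lt i); rewrite leq_addr.
have f1W i : f1 i \in W 0.
  have := winding_mem x wq; rewrite /f1 -/p => /(_ (L * i)).
  by rewrite -(size_rev q) modnMr; apply; exact: pos_lt1.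
have f2W i : f2 i \in W b.
  have hi : L * i + d < size q by rewrite -(size_rev q); exact: pos_lt.
  have dL : (L * i + d) %% L = b.
    by rewrite /d addnA -mulnDr mulnC modnMDl modn_small.
  by have := winding_mem x wq hi; rewrite dL.
have f1_inj : injective f1.
  move=> i1 i2 /eqP; rewrite /f1 nth_uniq // eqn_pmul2l // => /eqP.
  exact: ord_inj.
have f2_inj : injective f2.
  move=> i1 i2 /eqP; rewrite /f2 nth_uniq // eqn_add2r eqn_pmul2l // => /eqP.
  exact: ord_inj.
have few (X Y : {set V}) (f : 'I_(k + k) -> V) : injective f ->
    (forall i, f i \in Y) -> #|Y :\: nbhd e X| < k ->
    #|[set i | f i \notin nbhd e X]| < k.
  move=> f_inj fY; apply: leq_ltn_trans; rewrite -(card_imset _ f_inj).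
  apply/subset_leq_card/subsetP => y /imsetP[i]; rewrite inE => iN ->.
  by rewrite inE iN fY.
have few1 : #|[set i | f1 i \notin nbhd e S]| < k.
  apply: (few _ _ _ f1_inj f1W); apply: (joined_nbhd (X := U 1)).
  - by apply: joinedS (fintype.subxx _) (W_sub 0) _; exact: U_joined'.
  - exact: fintype.subset_trans SZ (slice_sub _ _ _).
  - by rewrite cS.
have few2 : #|[set i | f2 i \notin nbhd e T']| < k.
  apply: (few _ _ _ f2_inj f2W); apply: joined_nbhd T'U kT'.
  apply: joinedS (fintype.subxx _) (W_sub b) _.
  rewrite (ltnW bN); apply: U_joined'; rewrite ?(ltnW bN) //.
    by case: (b) bN => //= b' /ltnW/ltnW.
  by case: (b) => //= b'; rewrite eqxx.
(* Of the [2k] segments fewer than [k] start outside the neighborhood of [S] and fewer than [k] end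
   outside that of [T']. *)
have /set0Pn[i] : ~: ([set i | f1 i \notin nbhd e S] :|:
    [set i | f2 i \notin nbhd e T']) != set0.
  rewrite -card_gt0 cardsCs setCK card_ord.
  have := cardsU_le [set i | f1 i \notin nbhd e S]
    [set i | f2 i \notin nbhd e T'].
  by move: few1 few2; clear; lia.
rewrite !inE negb_or !negbK.
move=> /andP[/exists_inP[y1 y1S e1] /exists_inP[y2 y2T e2]].
have [pS [epS lpS spS upS pSU]] := rS _ y1S.
have [pT [epT lpT spT upT pTU]] := rT' _ y2T.
pose seg := take d.+1 (drop (L * i) p).
have sseg : size seg = d.+1.
  by rewrite size_takel // size_drop ltn_subRL; exact: pos_lt.
have seg0 : nth x seg 0 = f1 i by rewrite nth_take // nth_drop addn0.
have segd : last x seg = f2 i by rewrite -nth_last sseg nth_take // nth_drop.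
have seg_sorted : sorted e seg.
  apply/take_sorted/drop_sorted/(sortedP x) => c cp.
  by apply: winding_edge wq _; rewrite -(size_rev q).
have segW y : y \in seg -> exists2 c, c < L & y \in W c.
  move=> /mem_take/mem_drop yp; exists (index y p %% L).
    by rewrite ltn_pmod.
  rewrite -{1}(nth_index x yp); apply: winding_mem wq _.
  by rewrite -(size_rev q) index_mem.
have W_slice c y : c < L -> y \in W c ->
    exists2 a, a <= N & y \in slice (U a) 0 (w + w).
  rewrite /W => cL; case: leqP => cN; rewrite inE => /andP[yU iy].
    by exists c; rewrite // inE yU; move: iy; clear; lia.
  exists (L - c); first by move: cN; rewrite /L; clear; lia.
  by rewrite inE yU; move: iy; clear; lia.
have segZ y : y \in seg -> y \notin Z 0 :|: Z 1.
  move=> /segW[c cL /(W_slice _ _ cL)[a aN ya]]; rewrite in_setU.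
  apply/negP => /orP[] yZ.
    by have [_] := slice_disj aN (leq0n N) ya yZ; clear; lia.
  by have [_] := slice_disj aN N_gt0 ya yZ; clear; lia.
have segR y c : c < N -> y \in seg -> y \notin Rs c.
  move=> cN /segW[c' cL /(W_slice _ _ cL)[a aN ya]]; apply/negP => yR.
  by have [_] := slice_disj aN (ltnW cN) ya yR; clear; lia.
have RsZ y c : c < N -> y \in Rs c -> y \notin Z 0 :|: Z 1.
  move=> cN yR; apply/negP; rewrite in_setU => /orP[] yZ.
    by have [_] := slice_disj (ltnW cN) (leq0n N) yR yZ; clear; lia.
  by have [_] := slice_disj (ltnW cN) N_gt0 yR yZ; clear; lia.
have pTN y : y \in pT -> [/\ y != x, y \notin US & y \notin seg].
  move=> /pTU; rewrite in_setU => /orP[yUT|/bigcupP[c _ yR]].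
    split.
    - by apply: contraNneq xUT => <-.
    - apply/negP => yUS; move/disjoint_setI0/setP: dU => /(_ y).
      by rewrite !inE yUS yUT.
    - by apply: contraL (subsetP UTZ _ yUT) => /segZ.
  have cN : c < N := ltn_trans (ltn_ord c) bN.
  have yZ := RsZ _ _ cN yR; split.
  - by apply: contraNneq yZ => ->; rewrite in_setU xZ orbT.
  - by apply: contra yZ => /(subsetP USZ).
  - by apply: contraL yR => /segR; apply.
have pSN y : y \in pS -> y \notin seg.
  by move=> /pSU/(subsetP USZ); apply: contraL => /segZ.
exists (x :: pS ++ seg ++ rev pT); split.
- rewrite /= !size_cat size_rev spS spT sseg tE hE /d /L.
  by clear; lia.
- rewrite /= !mem_cat !cat_uniq upS rev_uniq upT take_uniq ?drop_uniq //.
  rewrite mem_rev !andbT.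
  rewrite !negb_or /=; apply/and3P; split.
  + apply/and3P; split.
    * by apply/negP => /pSU; apply/negP.
    * by apply/negP => /segZ; rewrite in_setU xZ orbT.
    * by apply/negP => /pTN[]; rewrite eqxx.
  + rewrite has_cat negb_or; apply/andP; split; apply/hasPn => y.
      by apply: contraL => /pSN.
    rewrite mem_rev => /pTN[_ yU _]; apply: contra yU; exact: pSU.
  + by apply/hasPn => y; rewrite mem_rev => /pTN[].
rewrite /= -!cats1 -!catA cats1 -rev_cons !cat_path epS lpS /=.
rewrite lastI lpT rev_rcons /= -lpT rev_path lpT.
have -> : path (fun z => e^~ z) x pT = path e x pT.
  by apply: eq_path => u v; rewrite /= e_sym.
rewrite epT andbT.
case: (seg) sseg seg0 segd seg_sorted => [//|y0 seg'] _ /= -> -> ->.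
by rewrite e1 e_sym e2.
Qed.

End Embedding.

(** * Qualitative regularity *)

Section Equipartition.
Variable V : finType.
Implicit Types (X Y Z : {set V}) (PP AA : {set {set V}}) (s : nat).

(** The parts need not cover [V]; the leftover is bounded separately. *)
Definition equipart s PP := trivIset PP /\ {in PP, forall X, #|X| = s}.

Lemma card_equipart s PP : 0 < s -> equipart s PP -> #|cover PP| = #|PP| * s.
Proof.
move=> s_gt0 [tPP cPP]; apply: card_uniform_partition => //.
rewrite /partition eqxx tPP /=; apply/negP => /cPP; rewrite cards0.
by move: s_gt0; clear; lia.
Qed.

(** Greedy: the sets of [AA] split [Z] into at most [2 ^ #|AA|] atoms, so while more than
    [2 ^ #|AA| * s] vertices remain, some atom still contains [s] of them. *)
Lemma chop s AA Z : 0 < s -> exists PP,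
  [/\ equipart s PP, cover PP \subset Z, #|Z :\: cover PP| <= 2 ^ #|AA| * s
    & {in PP & AA, forall X (A : {set V}), X \subset A \/ [disjoint X & A]}].
Proof.
move=> s_gt0; have [m] := ubnP #|Z|; elim: m Z => // m IH Z Zm.
case: (leqP #|Z| (2 ^ #|AA| * s)) => [small|big].
  exists set0; split.
  - by split=> [|X]; rewrite ?inE //; apply/trivIsetP => X; rewrite inE.
  - by rewrite /cover big_set0 sub0set.
  - by rewrite /cover big_set0 setD0.
  - by move=> X A; rewrite inE.
pose sig x := [set A in AA | x \in A].
pose fib t := [set x in Z | sig x == t].
have /exists_inP[t tAA fib_big] : [exists t in powerset AA, s <= #|fib t|].
  rewrite -[[exists t in _, _]]negbK; apply/negP => /exists_inPn no.
  move: big; rewrite ltnNge => /negP; apply.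
  rewrite -card_powerset -sum_nat_const -sum1_card.
  rewrite (partition_big sig (mem (powerset AA))) /=; last first.
    by move=> x _; rewrite powersetE; apply/subsetP => A; rewrite inE => /andP[].
  apply: leq_sum => t tAA; have := no t tAA; rewrite -ltnNge => /ltnW.
  by apply: leq_trans; rewrite /fib sum1dep_card.
have [X Xfib cX] := subset_of_card fib_big.
have XZ : X \subset Z.
  by apply/subsetP => x /(subsetP Xfib); rewrite inE => /andP[].
have [|PP [[tPP cPP] covPP rest hom]] := IH (Z :\: X).
  by have := cardsID X Z; rewrite (setIidPr XZ) cX; move: s_gt0 Zm; clear; lia.
have dX : {in PP, forall Y, [disjoint X & Y]}.
  move=> Y YPP; rewrite disjoint_sym disjoints_subset.
  apply: fintype.subset_trans (bigcup_sup Y YPP) _.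
  by apply: fintype.subset_trans covPP _; rewrite setDE subsetIr.
have n0 : set0 \notin PP.
  by apply/negP => /cPP; rewrite cards0; move: s_gt0; clear; lia.
have [tXPP XPP] := trivIsetU1 dX tPP n0.
have covE : cover (X |: PP) = X :|: cover PP by rewrite /cover big_setU1.
exists (X |: PP); split.
- by split=> // Y; rewrite in_setU1 => /predU1P[->|/cPP].
- rewrite covE subUset XZ; apply: fintype.subset_trans covPP _.
  exact: subsetDl.
- by rewrite covE -setDDl.
- move=> Y A; rewrite in_setU1 => /predU1P[->|/hom]; last exact.
  move=> AAA; have [At|At] := boolP (A \in t); [left|right].
    apply/subsetP => x /(subsetP Xfib); rewrite inE => /andP[_ /eqP sx].
    by move: At; rewrite -sx inE => /andP[].
  rewrite disjoints_subset; apply/subsetP => x /(subsetP Xfib).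
  rewrite !inE => /andP[_ /eqP sx]; move: At; rewrite -sx inE AAA.
  by [].
Qed.

End Equipartition.

Lemma card_bigcup_le (I T : finType) (F : I -> {set T}) :
  #|\bigcup_i F i| <= \sum_i #|F i|.
Proof.
apply: (big_ind2 (fun (A : {set T}) m => #|A| <= m)) => [|A m B p Am Bp|//].
  by rewrite cards0.
exact: leq_trans (cardsU_le A B) (leq_add Am Bp).
Qed.

Section Refinement.
Variables (V : finType) (r : nat) (col : 'I_r -> rel V).
Implicit Types (X Y Z A B : {set V}) (PP AA : {set {set V}}) (s k : nat).

Definition hole_in e k X Y (AB : {set V} * {set V}) :=
  [&& AB.1 \subset X, AB.2 \subset Y, k <= #|AB.1|, k <= #|AB.2|
    & noedge e AB.1 AB.2].

Definition bad k X Y := [forall c, [exists AB, hole_in (col c) k X Y AB]].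

Definition bad_pairs k PP :=
  [set XY in setX PP PP | (XY.1 != XY.2) && bad k XY.1 XY.2].

Definition empty_pairs c PP := [set xy : V * V | [exists X in PP,
  [exists Y in PP, [&& xy.1 \in X, xy.2 \in Y & noedge (col c) X Y]]]].

(** Takes the place of the mean square density in the usual regularity lemma. *)
Definition energy PP := \sum_c #|empty_pairs c PP|.

Let sum_r m : r * m = \sum_(c < r) m.
Proof. by rewrite sum_nat_const card_ord. Qed.

Lemma energy_le PP : energy PP <= r * #|V| ^ 2.
Proof.
rewrite /energy sum_r; apply: leq_sum => c _.
by rewrite -mulnn -card_prod max_card.
Qed.

Lemma empty_pairsP c PP x y :
  reflect (exists X Y, [/\ X \in PP, Y \in PP, x \in X, y \in Y
                         & noedge (col c) X Y])
          ((x, y) \in empty_pairs c PP).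
Proof.
rewrite inE; apply: (iffP exists_inP).
  move=> [X XP /exists_inP[Y YP]].
  by case/and3P=> xX yY n; exists X, Y.
move=> [X [Y [XP YP xX yY n]]].
by exists X => //; apply/exists_inP; exists Y; rewrite //= xX yY.
Qed.

(** Refine along the parts and one hole per color and pair. Some color has an edge between the parts
    of a bad pair by [dense], so the at least [k ^ 2] vertex pairs in its hole of that color are
    newly counted. Only vertex pairs meeting the leftover get lost. *)
Lemma energy_increment s s' k PP : 0 < s' -> equipart s PP ->
  {in PP &, forall X Y, X != Y -> exists c, ~~ noedge (col c) X Y} ->
  exists PP', [/\ equipart s' PP', cover PP' \subset cover PP,
    #|cover PP :\: cover PP'| <= 2 ^ (#|PP| + 2 * (r * #|PP| ^ 2)) * s'
  & energy PP + #|bad_pairs k PP| * k ^ 2 <=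
    energy PP' + r * (2 * (#|V| * #|cover PP :\: cover PP'|))].
Proof.
move=> s'_gt0 [tPP cPP] dense.
(* The default, a pair of empty sets, is never taken at a bad pair. *)
pose h c (XY : {set V} * {set V}) :=
  odflt (set0, set0) [pick AB | hole_in (col c) k XY.1 XY.2 AB].
have hP c XY : XY \in bad_pairs k PP -> hole_in (col c) k XY.1 XY.2 (h c XY).
  rewrite inE => /and3P[_ _ /forallP/(_ c)/existsP[AB hAB]].
  by rewrite /h; case: pickP => [//|/(_ AB)]; rewrite hAB.
pose D := setX [set: 'I_r] (setX PP PP).
pose AA := PP :|: ([set (h u.1 u.2).1 | u in D] :|: [set (h u.1 u.2).2 | u in D]).
have cD : #|D| = r * #|PP| ^ 2 by rewrite !cardsX cardsT card_ord mulnn.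
have cAA : #|AA| <= #|PP| + 2 * (r * #|PP| ^ 2).
  rewrite -cD mul2n -addnn; apply: leq_trans (cardsU_le _ _) _.
  rewrite leq_add2l; apply: leq_trans (cardsU_le _ _) _.
  by rewrite leq_add // leq_imset_card.
have [PP' [ePP' covPP' rest hom]] := chop AA (cover PP) s'_gt0.
exists PP'; split=> //.
  by apply: leq_trans rest _; rewrite leq_mul2r leq_exp2l // cAA orbT.
set Lf := cover PP :\: cover PP'.
(* Only bad pairs with an edge of color [c] gain in this color; the others were counted as empty
   before. *)
pose badc c := [set XY in bad_pairs k PP | ~~ noedge (col c) XY.1 XY.2].
have block X x : X \in PP -> x \in X -> pblock PP x = X by exact: def_pblock.
suff step c : #|empty_pairs c PP| + #|badc c| * k ^ 2 <=
    #|empty_pairs c PP'| + 2 * (#|V| * #|Lf|).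
  have le : #|bad_pairs k PP| * k ^ 2 <= (\sum_c #|badc c|) * k ^ 2.
    rewrite leq_mul2r; apply/orP; right.
    apply: leq_trans (card_bigcup_le badc).
    apply/subset_leq_card/subsetP => -[X Y] XYb.
    move: (XYb); rewrite !inE /= => /andP[/andP[XP YP] /andP[ne _]].
    have [c nc] := dense _ _ XP YP ne; apply/bigcupP; exists c => //.
    by rewrite inE XYb.
  apply: leq_trans (leq_add (leqnn (energy PP)) le) _.
  rewrite big_distrl /= sum_r -!big_split /=.
  exact: leq_sum.
pose F := [set xy : V * V | [exists XY in badc c,
   (xy.1 \in (h c XY).1) && (xy.2 \in (h c XY).2)]].
have FP x y : (x, y) \in F -> exists X Y,
   [/\ (X, Y) \in badc c, X \in PP, Y \in PP,
    x \in (h c (X, Y)).1 & y \in (h c (X, Y)).2].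
  rewrite inE => /exists_inP[[X Y] XYb /andP[xA yB]]; exists X, Y; split=> //.
    by move: XYb; rewrite !inE /= => /andP[/andP[/andP[]]].
  by move: XYb; rewrite !inE /= => /andP[/andP[/andP[]]].
have badcP X Y : (X, Y) \in badc c -> hole_in (col c) k X Y (h c (X, Y)).
  by rewrite inE => /andP[XYb _]; exact: hP.
have F_big : #|badc c| * k ^ 2 <= #|F|.
  (* The holes of different pairs of parts give disjoint rectangles, because [x] and [y] determine
     their blocks. *)
  pose g (xy : V * V) := (pblock PP xy.1, pblock PP xy.2).
  apply: leq_trans (_ : \sum_(XY in badc c) \sum_(xy in F) (g xy == XY) <= _);
    last first.
    rewrite exchange_big /= -sum1_card; apply: leq_sum => xy _.
    case: (boolP (g xy \in badc c)) => gb; last first.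
      by rewrite big1 // => XY XYb; case: eqP => // E; rewrite E XYb in gb.
    rewrite (bigD1 (g xy)) //= eqxx big1 // => XY /andP[_].
    by rewrite eq_sym => /negbTE ->.
  rewrite -sum_nat_const; apply: leq_sum => -[X Y] XYb.
  have /and5P[/= AX BY kA kB _] := badcP _ _ XYb.
  have /andP[XP YP] : (X \in PP) && (Y \in PP).
    by move: XYb; rewrite !inE /= => /andP[/andP[]].
  rewrite -mulnn; apply: leq_trans (leq_mul kA kB) _; rewrite -cardsX -sum1_card.
  rewrite [leqRHS](bigID (mem (setX (h c (X, Y)).1 (h c (X, Y)).2))) /=.
  apply: leq_trans (leq_addr _ _).
  rewrite [leqRHS](eq_bigl (mem (setX (h c (X, Y)).1 (h c (X, Y)).2)));
    last first.
    move=> [x y] /=; apply: andb_idl; rewrite in_setX => /andP[xA yB].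
    by rewrite inE; apply/exists_inP; exists (X, Y); rewrite // xA yB.
  apply: leq_sum => -[x y]; rewrite in_setX => /andP[xA yB].
  by rewrite /g /= (block X) ?(block Y) ?eqxx // ?(subsetP AX) ?(subsetP BY).
have F_disj : [disjoint empty_pairs c PP & F].
  rewrite -setI_eq0; apply/eqP/setP => -[x y]; rewrite [LHS]in_setI in_set0.
  apply/negP => /andP[/empty_pairsP[X' [Y' [X'P Y'P xX' yY' n]]] /FP].
  move=> [X [Y [XYb XP YP xA yB]]].
  have /and5P[/= /subsetP/(_ x xA) xX /subsetP/(_ y yB) yY _ _ _] :=
    badcP _ _ XYb.
  move: XYb n; rewrite inE => /andP[_] /=.
  rewrite -(block _ _ XP xX) -(block _ _ YP yY).
  by rewrite (block _ _ X'P xX') (block _ _ Y'P yY') => /negbTE ->.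
apply: leq_trans (leq_add (leqnn _) F_big) _.
have -> : #|empty_pairs c PP| + #|F| = #|empty_pairs c PP :|: F|.
  by rewrite cardsU (disjoint_setI0 F_disj) cards0 subn0.
apply: leq_trans (_ : #|empty_pairs c PP' :|:
  (setX Lf setT :|: setX setT Lf)| <= _); last first.
  apply: leq_trans (cardsU_le _ _) _; rewrite leq_add2l.
  apply: leq_trans (cardsU_le _ _) _; rewrite !cardsX cardsT mulnC.
  by rewrite addnn mul2n.
apply/subset_leq_card/subsetP => -[x y] xyEF.
have [A [B [[xA yB] [AAA AAB] [AZ BZ] nAB]]] : exists A B : {set V},
    [/\ x \in A /\ y \in B, A \in AA /\ B \in AA,
      A \subset cover PP /\ B \subset cover PP & noedge (col c) A B].
  move: xyEF; rewrite in_setU => /orP[/empty_pairsP[X [Y [XP YP xX yY n]]]|].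
    exists X, Y; split=> //; first by rewrite !in_setU XP YP.
    by split; apply: bigcup_sup.
  move=> /FP[X [Y [XYb XP YP xA yB]]].
  have /and5P[/= AX BY _ _ n] := badcP _ _ XYb.
  have XYD : (c, (X, Y)) \in D by rewrite !in_setX inE XP YP.
  exists (h c (X, Y)).1, (h c (X, Y)).2; split=> //; split.
  - by rewrite !in_setU; apply/or3P/Or32; apply/imsetP; exists (c, (X, Y)).
  - by rewrite !in_setU; apply/or3P/Or33; apply/imsetP; exists (c, (X, Y)).
  - exact: fintype.subset_trans AX (bigcup_sup X XP).
  - exact: fintype.subset_trans BY (bigcup_sup Y YP).
have in_Lf z (C : {set V}) : z \in C -> C \subset cover PP -> C \in AA ->
    z \in Lf \/ exists X, [/\ X \in PP', z \in X & X \subset C].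
  move=> zC CZ CAA; have [zc|zc] := boolP (z \in cover PP'); last first.
    by left; rewrite in_setD zc (subsetP CZ).
  move/bigcupP: zc => [X XP' zX]; right; exists X; split=> //.
  have [//|/disjoint_setI0/setP/(_ z)] := hom _ _ XP' CAA.
  by rewrite !inE zX zC.
rewrite !in_setU !in_setX !in_setT andbT /=.
have [->|[X [XP xX XA]]] := in_Lf _ _ xA AZ AAA; first by rewrite orbT.
have [->|[Y [YP yY YB]]] := in_Lf _ _ yB BZ AAB; first by rewrite !orbT.
apply/orP; left; apply/empty_pairsP; exists X, Y; split=> //.
exact: noedgeS nAB.
Qed.

End Refinement.

Section Regularity.
Variables (r q : nat).
Hypotheses (r_gt0 : 0 < r) (q_ge3 : 3 <= q).

(** The energy is at most [r n^2], and each round gains [n^2 / (8 q^3)], so [M] rounds exhaust it. A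
    round loses at most [n / B] vertices, which keeps the total leftover below [3n / (2q)]. *)
Let M := 8 * q ^ 3 * r.
Let B := 2 * q * M.

Let q_gt0 : 0 < q. Proof. exact: leq_trans q_ge3. Qed.

Let M_gt0 : 0 < M.
Proof. by rewrite muln_gt0 r_gt0 andbT muln_gt0 expn_gt0 q_gt0. Qed.

Definition dense_union H (V : finType) (col : 'I_r -> rel V) :=
  forall X Y : {set V}, [disjoint X & Y] -> #|V| <= H * #|X| ->
    #|V| <= H * #|Y| -> exists c, ~~ noedge (col c) X Y.

Definition regular (V : finType) (col : 'I_r -> rel V) s PP :=
  #|bad_pairs col (s %/ q).+1 PP| * q <= #|PP| ^ 2.

(** More than [K^2 / q] bad pairs, each gaining at least [(s / q)^2], add at least [n^2 / (4 q^3)],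
    as the parts cover half of the vertices. The leftover [l] costs at most half of this. *)
Let gain n K s nb e e' l m : n <= 2 * (K * s) -> K ^ 2 < nb * q ->
  l * B <= n -> M.+1 * n ^ 2 <= 8 * q ^ 3 * e + m.+1 * n ^ 2 ->
  e + nb * (s %/ q).+1 ^ 2 <= e' + r * (2 * (n * l)) ->
  M.+1 * n ^ 2 <= 8 * q ^ 3 * e' + m * n ^ 2.
Proof.
move=> nK Knb lB he hinc.
have kq : s <= (s %/ q).+1 * q by rewrite ltnW // ltn_ceil // (leq_trans _ q_ge3).
set k := (s %/ q).+1 in kq hinc *.
have h1 : n ^ 2 <= 4 * q ^ 3 * (nb * k ^ 2).
  apply: leq_trans (_ : (2 * (K * s)) ^ 2 <= _); first by rewrite leq_sqr.
  rewrite !expnMn -mulnA leq_mul2l /=.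
  apply: leq_trans (leq_mul (ltnW Knb) (_ : s ^ 2 <= (k * q) ^ 2)) _.
    by rewrite leq_sqr.
  by rewrite expnMn !expnS; lia.
have h2 : 8 * q ^ 3 * (r * (2 * (n * l))) <= n ^ 2.
  have : n * (l * (2 * M)) <= n * n.
    rewrite leq_mul2l; apply/orP; right; apply: leq_trans lB.
    by rewrite leq_mul2l /B leq_mul2r leq_pmulr ?orbT.
  by rewrite /M; lia.
have : 8 * q ^ 3 * (e + nb * k ^ 2) <= 8 * q ^ 3 * (e' + r * (2 * (n * l))).
  by rewrite leq_mul2l hinc orbT.
move: h1 h2 he; move: (q ^ 3) (nb * k ^ 2) (r * _) (n ^ 2) => Q Z T N.
by clear; lia.
Qed.

(** Induction on the number [m] of rounds left. The last two hypotheses record the leftover and the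
    energy after [M.+1 - m] rounds; at [m = 0] the energy would exceed its maximum. [H] depends on
    [m] and [h] only, hence is chosen before the graph. *)
Let regularity_iter m : forall h, exists H, forall (V : finType)
  (col : 'I_r -> rel V), H <= #|V| -> dense_union H col ->
  forall s PP, equipart s PP -> 0 < s -> #|V| <= h * s ->
  #|~: cover PP| * B + m * #|V| <= (2 * M).+1 * #|V| ->
  M.+1 * #|V| ^ 2 <= 8 * q ^ 3 * energy col PP + m * #|V| ^ 2 ->
  exists s' PP', [/\ equipart s' PP', 0 < s' <= s, #|V| <= H * s',
    2 * (#|~: cover PP'| * q) <= 3 * #|V| & regular col s' PP'].
Proof.
elim: m => [|m IH] h.
  exists 1 => V col n1 _ s PP _ _ _ _.
  have := energy_le col PP; rewrite mul0n addn0 => /(leq_mul (leqnn (8 * q ^ 3))).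
  rewrite mulnA -/M => h1 /leq_trans/(_ h1).
  by rewrite leq_pmul2r ?ltnn // expn_gt0 n1.
(* With at most [h] parts, [tau] bounds the number of atoms of the refinement; new parts of size
   [n / (B * tau)] then leave over at most [n / B] vertices. *)
pose tau := 2 ^ (h + 2 * (r * h ^ 2)).
have [H2 hH2] := IH (2 * (B * tau)).
exists (H2 + h + B * tau) => V col nH dense s PP ePP s0 nh hcov hen.
set n := #|V| in nH dense nh hcov hen *.
have B0 : 0 < B by rewrite muln_gt0 M_gt0 andbT muln_gt0.
have tau_gt : h < tau.
  by apply: leq_trans (ltn_expl h (isT : 1 < 2)) _; rewrite leq_exp2l ?leq_addr.
have Bt : h < B * tau by apply: leq_trans tau_gt _; rewrite leq_pmull.
have Bt0 : 0 < B * tau by case: (B * tau) Bt.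
have cov : #|cover PP| = #|PP| * s := card_equipart s0 ePP.
have covC : #|PP| * s + #|~: cover PP| = n by rewrite -cov cardsC.
have Kh : #|PP| <= h.
  by rewrite -(leq_pmul2r s0); apply: leq_trans nh; rewrite -covC leq_addr.
have uq : 2 * (#|~: cover PP| * q) <= 3 * n.
  rewrite -(leq_pmul2r M_gt0).
  apply: leq_trans (_ : (2 * M).+1 * n <= _).
    apply: leq_trans hcov; apply: leq_trans (leq_addr _ _).
    by rewrite /B; lia.
  by rewrite mulnAC leq_mul2r; move: M_gt0; clear; lia.
case: (boolP (#|bad_pairs col (s %/ q).+1 PP| * q <= #|PP| ^ 2)) => [reg|].
  exists s, PP; split=> //; first by rewrite s0 leqnn.
  by apply: leq_trans nh _; rewrite leq_mul2r -addnA addnCA leq_addr orbT.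
rewrite -ltnNge => irr.
have n2K : n <= 2 * (#|PP| * s).
  have : 2 * (#|~: cover PP| * 3) <= 3 * n.
    by apply: leq_trans uq; rewrite !leq_mul2l q_ge3 !orbT.
  by move: covC; clear; lia.
pose s' := n %/ (B * tau).
have s'0 : 0 < s'.
  by rewrite divn_gt0 //; apply: leq_trans nH; rewrite leq_addl.
have s'B : s' * (B * tau) <= n by exact: leq_trunc_div.
have s's : s' <= s.
  rewrite -(leq_pmul2r Bt0); apply: leq_trans s'B _; apply: leq_trans nh _.
  by rewrite mulnC leq_mul2l (ltnW Bt) orbT.
have nh2 : n <= 2 * (B * tau) * s'.
  apply: leq_trans (ltnW (ltn_ceil n Bt0)) _; rewrite -/s' mulnAC.
  by rewrite leq_mul2r; move: s'0; clear; lia.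
have dense' : {in PP &, forall X Y, X != Y -> exists c, ~~ noedge (col c) X Y}.
  move=> X Y XP YP XY; have nX Z : Z \in PP -> n <= (H2 + h + B * tau) * #|Z|.
    move=> ZP; rewrite (ePP.2 _ ZP); apply: leq_trans nh _.
    by rewrite leq_mul2r -addnA addnCA leq_addr orbT.
  by apply: dense; rewrite ?nX //; move/trivIsetP: (ePP.1); apply.
have [PP' [ePP' cov' lef inc]] := energy_increment (s %/ q).+1 s'0 ePP dense'.
set l := #|_ :\: _| in lef inc.
have lB : l * B <= n.
  have lt : l <= tau * s'.
    apply: leq_trans lef _; rewrite leq_mul2r leq_exp2l // leq_add ?orbT //.
    by rewrite !leq_mul2l leq_sqr Kh !orbT.
  apply: leq_trans (leq_mul lt (leqnn B)) _.
  by rewrite -mulnA mulnC -mulnA.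
have covl : #|~: cover PP'| <= #|~: cover PP| + l.
  apply: leq_trans (cardsU_le _ _); apply/subset_leq_card/subsetP => x.
  by rewrite !inE => ->; rewrite /= orNb.
have [||||s2 [PP2 [e2 /andP[s20 s2s] n2 u2 reg2]]] :=
  hH2 V col _ _ s' PP' ePP' s'0 nh2.
- by apply: leq_trans nH; rewrite -addnA leq_addr.
- move=> X Y dXY nX nY; apply: dense => //.
    by apply: leq_trans nX _; rewrite leq_mul2r -addnA leq_addr orbT.
  by apply: leq_trans nY _; rewrite leq_mul2r -addnA leq_addr orbT.
- apply: leq_trans hcov; rewrite mulSn addnA leq_add2r.
  by apply: leq_trans (leq_mul covl (leqnn B)) _; rewrite mulnDl leq_add2l.
- exact: gain n2K irr lB hen inc.
exists s2, PP2; split=> //; first by rewrite s20 (leq_trans s2s).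
by apply: leq_trans n2 _; rewrite leq_mul2r -addnA leq_addr orbT.
Qed.

(** The iteration starts from an arbitrary partition into parts of size [s0], about [n / h0]. It
    leaves over at most [s0] vertices, which is at most [n / (2q) = M n / B]. Later parts are no
    larger, so [h0 * s] stays at most [n]. *)
Lemma regularity h0 : 2 * q <= h0 -> exists H, forall (V : finType)
  (col : 'I_r -> rel V), H <= #|V| -> dense_union H col ->
  exists s PP, [/\ equipart s PP, 0 < s, h0 * s <= #|V| & #|V| <= H * s]
    /\ (2 * (#|~: cover PP| * q) <= 3 * #|V| /\ regular col s PP).
Proof.
move=> qh0; have [H hH] := regularity_iter M.+1 (2 * h0).
have h0_gt0 : 0 < h0 by apply: leq_trans qh0; move: q_ge3; clear; lia.
exists (H + h0) => V col nH dense; set n := #|V| in nH dense *.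
pose s0 := n %/ h0.
have s00 : 0 < s0 by rewrite divn_gt0 //; apply: leq_trans nH; rewrite leq_addl.
have s0h : s0 * h0 <= n by exact: leq_trunc_div.
have [PP [ePP _ rest _]] := chop set0 [set: V] s00.
have [|||||s [PP' [e' /andP[s'0 s's] nH' u' reg']]] := hH V col _ _ s0 PP ePP s00.
- by apply: leq_trans nH; rewrite leq_addr.
- move=> X Y dXY nX nY; apply: dense => //.
    by apply: leq_trans nX _; rewrite leq_mul2r leq_addr orbT.
  by apply: leq_trans nY _; rewrite leq_mul2r leq_addr orbT.
- apply: leq_trans (ltnW (ltn_ceil n h0_gt0)) _; rewrite -/s0 mulnAC.
  by rewrite leq_mul2r; move: s00; clear; lia.
- rewrite -setTD -/n; move: rest; rewrite cards0 mul1n => rest.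
  have : #|setT :\: cover PP| * B <= M * n.
    apply: leq_trans (leq_mul rest (leqnn B)) _; rewrite /B mulnA mulnC.
    rewrite leq_mul2l; apply/orP; right; apply: leq_trans s0h.
    by rewrite leq_mul2l qh0 orbT.
  by clear; lia.
- by rewrite leq_addl.
exists s, PP'; split=> //; split=> //.
  apply: leq_trans s0h; rewrite mulnC leq_mul2r s's orbT //.
by apply: leq_trans nH' _; rewrite leq_mul2r leq_addr orbT.
Qed.

End Regularity.

(** * The reduced graph *)

Lemma edges_sgraph_of_rel (V : finType) (g : rel V) (x y : V) :
  symmetric g -> x != y -> ([set x; y] \in edges (sgraph_of_rel g)) = g x y.
Proof.
move=> g_sym xy; apply/imset2P/idP => [[u v _]|gxy]; last first.
  by exists x y; rewrite ?inE ?xy.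
rewrite inE => /and3P[_ uv guv] E.
have := set21 x y; have := set22 x y; rewrite E !inE.
case/orP=> /eqP yE /orP[] /eqP xE; move: xy guv; rewrite xE yE ?eqxx // => _.
by rewrite g_sym.
Qed.

Lemma edge_path_graph N a : a < N ->
  [set inord a; inord a.+1] \in edges (path_graph N).
Proof.
move=> aN; apply/imset2P; exists (inord a : 'I_N.+1) (inord a.+1) => //.
rewrite !inE /= !inordK ?eqxx ?andbT //; last exact: ltnW.
by rewrite -val_eqE /= !inordK ?neq_ltn ?ltnSn //; exact: ltnW.
Qed.

Section MonoCycle.
Variables (V : finType) (r : nat) (G : sgraph V) (c : {set V} -> 'I_r).

Definition color_rel (i : 'I_r) : rel V :=
  fun x y => [&& x != y, [set x; y] \in edges G & c [set x; y] == i].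

Lemma color_rel_sym i : symmetric (color_rel i).
Proof. by move=> x y; rewrite /color_rel eq_sym setUC. Qed.

Lemma mono_cycle i (C : seq V) : 0 < size C -> uniq C -> cycle (color_rel i) C ->
  mono_copy G c i (cycle_graph (size C)).
Proof.
case: C => // x0 C _ uC cC; set t := size (x0 :: C).
pose f (j : 'I_t) := nth x0 (x0 :: C) j.
exists f => [j1 j2 /eqP|e /imset2P[x y _]].
  by rewrite nth_uniq // => /eqP/ord_inj.
rewrite inE => /and3P[_ xy /eqP yE] ->.
rewrite imsetU1 imset_set1.
suff /and3P[_ -> /eqP ->] : color_rel i (f x) (f y) by [].
have := ltn_ord x; rewrite {2}/t /= ltnS leq_eqVlt /f yE => /predU1P[xC|xC].
  have -> : (ordS x : nat) = 0 by rewrite /= xC /t /= modnn.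
  rewrite xC /= nth_last; move: cC; rewrite /= rcons_path => /andP[_].
  by case: (C).
have -> : (ordS x : nat) = x.+1 by rewrite /= modn_small // /t /= ltnS.
have /(pathP x0)/(_ x) := cC; rewrite size_rcons ltnS => /(_ (ltnW xC)).
by rewrite -rcons_cons nth_rcons /= ltnS (ltnW xC) nth_rcons xC.
Qed.

End MonoCycle.

Section ReducedGraph.
Variables (V : finType) (r : nat) (G : sgraph V) (c : {set V} -> 'I_r).
Variables (s k : nat) (PP : {set {set V}}).
Hypotheses (r_gt0 : 0 < r) (k_gt0 : 0 < k) (large : 50 * k <= s).
Hypothesis ePP : equipart s PP.

Let col := color_rel G c.
Let P (i : 'I_#|PP|) : {set V} := enum_val i.

Let hole i X Y := [exists AB, hole_in (col i) k X Y AB].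

Let hole_sym i X Y : hole i X Y = hole i Y X.
Proof.
suff h X' Y' : hole i X' Y' -> hole i Y' X' by apply/idP/idP; exact: h.
case/existsP=> -[A B] /and5P[/= AX BY kA kB n]; apply/existsP; exists (B, A).
apply/and5P; split=> //=; apply/noedgeP => x y xB yA.
by rewrite /col color_rel_sym; move/noedgeP: n; apply.
Qed.

Definition reduced_graph : sgraph 'I_#|PP| :=
  sgraph_of_rel (fun i j => ~~ bad col k (enum_val i) (enum_val j)).

Let bad_sym : symmetric (fun i j : 'I_#|PP| => ~~ bad col k (P i) (P j)).
Proof.
by move=> i j; congr (~~ _); apply: eq_forallb => l; exact: hole_sym.
Qed.

Lemma card_reduced_graph :
  'C(#|PP|, 2) <= #|edges reduced_graph| + #|bad_pairs col k PP|.
Proof.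
pose BI := [set ij : 'I_#|PP| * 'I_#|PP| |
  (ij.1 != ij.2) && bad col k (P ij.1) (P ij.2)].
have cBI : #|BI| <= #|bad_pairs col k PP|.
  pose g (ij : 'I_#|PP| * 'I_#|PP|) := (P ij.1, P ij.2).
  have g_inj : injective g.
    by move=> [i j] [i' j'] [/enum_val_inj-> /enum_val_inj->].
  rewrite -(card_imset _ g_inj).
  apply/subset_leq_card/subsetP => XY /imsetP[[i j]].
  rewrite inE /= => /andP[ij b] ->; rewrite !inE /= !enum_valP b andbT /=.
  by rewrite andbT; apply: contraNneq ij => /enum_val_inj ->.
rewrite -{1}(card_ord #|PP|) -card_draws.
have cI := leq_trans (leq_imset_card (fun ij => [set ij.1; ij.2]) BI) cBI.
apply: leq_trans (leq_add (leqnn #|edges reduced_graph|) cI).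
apply: leq_trans (cardsU_le _ _); apply/subset_leq_card/subsetP => A.
rewrite inE => /cards2P[i [j [ij ->]]]; rewrite in_setU edges_sgraph_of_rel //.
have [b|//] := boolP (bad _ _ _ _); rewrite /=; apply/imsetP; exists (i, j) => //.
by rewrite inE ij.
Qed.

(** Color an edge of the reduced graph by a color in which its two parts are joined. A monochromatic
    path is then a chain of parts as in [even_cycle_embedding]. *)
Lemma reduced_arrows N : 0 < N -> arrows r reduced_graph (path_graph N) ->
  exists i, forall t, ~~ odd t -> 2 * trunc_log 2 #|V| + 2 <= t ->
    t <= N * (s - 50 * k) -> mono_copy G c i (cycle_graph t).
Proof.
(* A coloring takes unordered sets, so [good] speaks of all ordered pairs in [S]; [hole_sym] makes
   this harmless. The default color is never taken at an edge of the reduced graph. *)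
move=> N_gt0; pose good i (S : {set 'I_#|PP|}) :=
  [forall u in S, forall v in S, (u != v) ==> ~~ hole i (P u) (P v)].
pose cD S := odflt (Ordinal r_gt0) [pick i | good i S].
move=> /(_ cD)[i [f f_inj f_edge]]; exists i => t ot tlow thigh.
have cDP u v : u != v -> [set u; v] \in edges reduced_graph ->
    cD [set u; v] = i -> joined (col i) k (P u) (P v).
  move=> uv; rewrite edges_sgraph_of_rel // => nb; rewrite /cD.
  case: pickP => [l|no].
    move=> /forall_inP/(_ u); rewrite set21 => /(_ isT)/forall_inP/(_ v).
    rewrite set22 uv => /(_ isT) /= /existsPn nh /= <- A B AX BY kA kB.
    by have := nh (A, B); rewrite /hole_in /= AX BY kA kB.
  have /forallPn[l hl] := nb.
  have := no l; rewrite /good => /negP[]; apply/forall_inP => u' hu.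
  apply/forall_inP => v' hv; apply/implyP => uv'.
  move: hu hv; rewrite !inE => /orP[] /eqP Eu /orP[] /eqP Ev; subst u' v';
    rewrite ?eqxx // in uv' *.
  by rewrite hole_sym.
pose U a := P (f (inord a)).
have [|a|a b x aN bN xa xb|a aN|C [sC uC cC]] :=
  @even_cycle_embedding V (col i) k N s U _ k_gt0 N_gt0 _ _ _ large
    t ot tlow thigh.
- exact: color_rel_sym.
- by move=> _; apply: ePP.2; exact: enum_valP.
- have [//|ab] := eqVneq a b.
  have PP_ne : U a != U b.
    apply: contra ab => /eqP/enum_val_inj/f_inj/(congr1 val) /=.
    by rewrite !inordK // => ->.
  have /trivIsetP/(_ _ _ (enum_valP _) (enum_valP _) PP_ne) := ePP.1.
  by move/disjoint_setI0/setP/(_ x); rewrite !inE xa xb.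
- have := f_edge _ (edge_path_graph aN); rewrite imsetU1 imset_set1.
  move=> [fe fc]; apply: (cDP _ _ _ fe fc); apply/negP.
  move=> /eqP/f_inj/(congr1 val) /=.
  have aN' : a < N.+1 by rewrite ltnS ltnW.
  by rewrite !inordK // => /eqP; rewrite ltn_eqF.
rewrite -sC; apply: mono_cycle => //; rewrite sC.
by apply: leq_trans tlow; rewrite addn2.
Qed.

End ReducedGraph.

(** * Random graphs *)

From mathcomp Require Import all_order all_algebra.
From mathcomp Require Import all_classical all_reals all_analysis.
From mathcomp Require Import ring lra.
Import Order.TTheory GRing.Theory Num.Theory.
Import numFieldNormedType.Exports.
Local Open Scope ring_scope.

Definition joined_graph H n (G : sgraph 'I_n) :=
  [forall X : {set 'I_n}, forall Y : {set 'I_n},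
    [&& [disjoint X & Y], (n <= H * #|X|)%N & (n <= H * #|Y|)%N] ==>
    [exists x in X, exists y in Y, [set x; y]%SET \in edges G]].

Lemma dense_union_color H H' r n (G : sgraph 'I_n) (c : {set 'I_n} -> 'I_r) :
  (H <= H')%N -> joined_graph H' G -> dense_union H (color_rel G c).
Proof.
move=> HH' /forallP jG X Y dXY nX nY; rewrite card_ord in nX nY.
have /forallP/(_ Y)/implyP := jG X; rewrite dXY /=.
rewrite (leq_trans nX) ?leq_mul2r ?HH' ?orbT //.
rewrite (leq_trans nY) ?leq_mul2r ?HH' ?orbT // => /(_ isT).
case/exists_inP=> x xX /exists_inP[y yY xy]; exists (c [set x; y]%SET).
apply/negP => /noedgeP/(_ x y xX yY); rewrite /color_rel xy eqxx /= andbT.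
rewrite negbK => /eqP E; move/disjoint_setI0/setP: dXY => /(_ x).
by rewrite !inE xX E yY.
Qed.

Section Probability.
Variables (R : realType) (n : nat) (p : R).
Hypothesis p01 : 0 <= p <= 1.
Implicit Types G : sgraph 'I_n.

Lemma gnp_weight_ge0 G : 0 <= gnp_weight p G.
Proof.
by apply: prodr_ge0 => e _; case: ifP => _; case/andP: p01 => p0 p1;
  rewrite ?subr_ge0.
Qed.

(** Distributivity gives a sum over all families of vertex sets. Sets that are not pairs get the
    factors [0] if present and [1] if absent, which kills the families that are not graphs. *)
Lemma sum_sgraph_prod (a b : {set 'I_n} -> R) :
  \sum_G \prod_(e : {set 'I_n} | #|e| == 2) (if e \in edges G then a e else b e)
  = \prod_(e : {set 'I_n} | #|e| == 2) (a e + b e).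
Proof.
pose a' (e : {set 'I_n}) : R := if #|e| == 2 then a e else 0.
pose b' (e : {set 'I_n}) : R := if #|e| == 2 then b e else 1.
have -> : \prod_(e : {set 'I_n} | #|e| == 2) (a e + b e) = \prod_e (a' e + b' e).
  rewrite big_mkcond; apply: eq_bigr => e _; rewrite /a' /b'.
  by case: ifP => // _; rewrite add0r.
rewrite bigA_distr.
rewrite (bigID (fun J : {set {set 'I_n}} => [forall e in J, #|e| == 2])) /=.
rewrite [X in _ = _ + X]big1 ?addr0; last first.
  move=> J /forall_inPn[e eJ e2]; rewrite (bigD1 e) //= eJ /a' (negbTE e2).
  by rewrite mul0r.
rewrite (reindex_omap (@edges 'I_n) insub) /=; last first.
  by move=> J hJ; rewrite insubT.
apply: eq_big => [G|G _].
  by rewrite (valK G) eqxx edges_card2.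
rewrite big_mkcond; apply: eq_bigr => e _; rewrite /a' /b'.
have := forall_inP (edges_card2 G) e; case: (e \in edges G) => [->//|_].
by case: ifP.
Qed.

Lemma sum_gnp_weight : \sum_(G : sgraph 'I_n) gnp_weight p G = 1.
Proof.
rewrite /gnp_weight (sum_sgraph_prod (fun=> p) (fun=> 1 - p)) big1 // => e _.
by rewrite addrC subrK.
Qed.

(** Giving the pairs of [E0] weight [0] when present restricts the sum to the graphs avoiding
    them. *)
Lemma sum_gnp_weight_avoid (E0 : {set {set 'I_n}}) :
  {in E0, forall e : {set 'I_n}, #|e| == 2} ->
  \sum_(G : sgraph 'I_n | [disjoint edges G & E0]) gnp_weight p G =
    (1 - p) ^+ #|E0|.
Proof.
move=> hE0; rewrite big_mkcond /=.
transitivity (\sum_G \prod_(e : {set 'I_n} | #|e| == 2)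
   (if e \in edges G then (if e \in E0 then 0 else p) else 1 - p)).
  apply: eq_bigr => G _; case: ifP => [dG|/negbT].
    apply: eq_bigr => e _; case: ifP => // eG.
    by rewrite (disjointFr dG).
  case/pred0Pn=> e /= /andP[eG eE0]; rewrite (bigD1 e) /= ?hE0 //.
  by rewrite eG eE0 mul0r.
rewrite (sum_sgraph_prod (fun e => if e \in E0 then 0 else p) (fun=> 1 - p)).
rewrite (bigID (mem E0)) /= [X in _ * X]big1 ?mulr1; last first.
  by move=> e /andP[_ /negbTE ->]; rewrite addrC subrK.
rewrite -prodr_const; apply: eq_big => [e|e /andP[_ ->]]; last by rewrite add0r.
by apply/andP/idP => [[]//|eE]; split=> //; exact: hE0.
Qed.

(** Union bound over at most [4 ^ n] pairs: each fails with probability at most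
    [(1 - p) ^ (|X||Y|)], which is at most [exp(-7n)] and so at most [8 ^ -n], because [exp 7] is at
    least [1 + 7]. *)
Lemma gnp_prob_joined H : 7 * H%:R ^+ 2 / n%:R <= p -> (0 < H)%N -> (0 < n)%N ->
  1 - (2^-1) ^+ n <= gnp_prob p [set G : sgraph 'I_n | joined_graph H G]%classic.
Proof.
move=> hp H_gt0 n_gt0.
have p0 : 0 <= p by case/andP: p01.
pose pairs := [pred XY : {set 'I_n} * {set 'I_n} |
  [&& [disjoint XY.1 & XY.2], (n <= H * #|XY.1|)%N & (n <= H * #|XY.2|)%N]].
pose E0 (XY : {set 'I_n} * {set 'I_n}) :=
  [set [set xy.1; xy.2]%SET | xy in finset.setX XY.1 XY.2]%SET.
have total : gnp_prob p [set G : sgraph 'I_n | joined_graph H G]%classic +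
    \sum_(G : sgraph 'I_n | ~~ joined_graph H G) gnp_weight p G = 1.
  rewrite -sum_gnp_weight [RHS](bigID (@joined_graph H n)) /=; congr (_ + _).
  by apply: eq_bigl => G; apply/idP/idP => [/set_mem|hG] //; apply: mem_set.
suff: \sum_(G : sgraph 'I_n | ~~ joined_graph H G) gnp_weight p G <= 2^-1 ^+ n.
  by move: total; lra.
apply: le_trans (_ : \sum_(XY | pairs XY)
  \sum_(G : sgraph 'I_n | [disjoint edges G & E0 XY])
    gnp_weight p G <= _).
  rewrite (exchange_big_dep xpredT) //=.
  rewrite [X in _ <= X](bigID (@joined_graph H n)) /=.
  rewrite -[X in X <= _]add0r lerD //.
    by apply: sumr_ge0 => G _; apply: sumr_ge0 => XY _; exact: gnp_weight_ge0.
  apply: ler_sum => G /forallPn[X /forallPn[Y]].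
  rewrite negb_imply => /andP[XY /exists_inPn no].
  rewrite (bigD1 (X, Y)) /=; last first.
    rewrite XY /=; apply/pred0Pn => -[e /= /andP[eG /imsetP[[x y]]]].
    rewrite inE /= => /andP[xX yY] E; have /exists_inPn/(_ y yY) := no x xX.
    by rewrite -E eG.
  by rewrite lerDl; apply: sumr_ge0 => Z _; exact: gnp_weight_ge0.
apply: le_trans (_ : \sum_(XY | pairs XY) 8^-1 ^+ n <= _).
  apply: ler_sum => -[X Y] /= /and3P[dXY nX nY].
  rewrite sum_gnp_weight_avoid; last first.
    move=> e /imsetP[[x y]]; rewrite inE /= => /andP[xX yY] ->.
    rewrite cards2; case: (eqVneq x y) => // E.
    by move: (disjointFr dXY xX); rewrite E yY.
  rewrite card_in_imset; last first.
    move=> [x y] [x' y']; rewrite !inE /= => /andP[xX yY] /andP[x'X y'Y] E.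
    have xNy : x == y' = false.
      by apply/eqP => F; move: (disjointFr dXY xX); rewrite F y'Y.
    have yNx : y == x' = false.
      by apply/eqP => F; move: (disjointFr dXY x'X); rewrite -F yY.
    have := finset.set21 x y; have := finset.set22 x y.
    rewrite E !inE xNy yNx orbF /=.
    by move=> /eqP -> /eqP ->.
  rewrite cardsX.
  have nR : 0 < n%:R :> R by rewrite ltr0n.
  have HR : 0 < H%:R :> R by rewrite ltr0n.
  apply: le_trans (_ : expR (- p) ^+ (#|X| * #|Y|) <= _).
    rewrite lerXn2r ?nnegrE ?expR_ge0 //.
      by case/andP: p01; rewrite subr_ge0.
    exact: expR_ge1Dx.
  rewrite -expRM_natl.
  apply: le_trans (_ : expR (- (7 * n%:R)) <= _).
    rewrite ler_expR mulrN lerN2 natrM.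
    have hX : n%:R / H%:R <= #|X|%:R :> R.
      by rewrite ler_pdivrMr // -natrM ler_nat mulnC.
    have hY : n%:R / H%:R <= #|Y|%:R :> R.
      by rewrite ler_pdivrMr // -natrM ler_nat mulnC.
    have h0 : 0 <= n%:R / H%:R :> R by rewrite divr_ge0 ?ler0n.
    have h1 : (n%:R / H%:R) * (n%:R / H%:R) <= #|X|%:R * #|Y|%:R :> R.
      by rewrite ler_pM.
    have h2 : 0 <= 7 * H%:R ^+ 2 / n%:R :> R.
      by rewrite divr_ge0 ?mulr_ge0 ?exprn_ge0 ?ler0n.
    apply: le_trans (ler_pM (mulr_ge0 h0 h0) h2 h1 hp).
    rewrite le_eqVlt; apply/orP; left; apply/eqP.
    by field; rewrite !gt_eqF.
  have -> : - (7 * n%:R) = n%:R * (- 7) :> R by ring.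
  rewrite expRM_natl lerXn2r ?nnegrE ?expR_ge0 ?invr_ge0 //.
  rewrite expRN lef_pV2 ?posrE ?expR_gt0 //.
  by apply: le_trans (expR_ge1Dx 7); lra.
rewrite sumr_const -[leLHS]mulr_natl.
apply: le_trans (_ : (4 ^ n)%:R * 8^-1 ^+ n <= _).
  rewrite ler_wpM2r ?exprn_ge0 ?invr_ge0 // ler_nat.
  apply: leq_trans (max_card _) _.
  rewrite card_prod -cardsT -powersetT card_powerset cardsT card_ord.
  by rewrite -expnMn.
rewrite natrX -exprMn.
have -> : 4 * 8^-1 = 2^-1 :> R by field.
exact: lexx.
Qed.

End Probability.

Lemma gnp_whp_of_joined (R : realType) (p : nat -> R) H
    (E : forall n, set (sgraph 'I_n)) :
  (0 < H)%N -> (forall n, 0 <= p n <= 1) ->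
  (\forall n \near \oo%classic, 7 * H%:R ^+ 2 / n%:R <= p n) ->
  (\forall n \near \oo%classic,
     forall G : sgraph 'I_n, joined_graph H G -> E n G) ->
  gnp_whp p E.
Proof.
move=> H_gt0 p01 hp hE; rewrite /gnp_whp.
apply: (@squeeze_cvgr _ _ _ _ (fun n => 1 - 2^-1 ^+ n) (fun=> 1)); last first.
- exact: cvg_cst.
- rewrite -[X in (_ --> X)%classic]subr0; apply: cvgB; first exact: cvg_cst.
  by apply: cvg_expr; rewrite ger0_norm ?invr_ge0 // invf_lt1 // ltr1n.
near=> n.
have n_gt0 : (0 < n)%N by near: n; exact: nbhs_infty_gt.
have pn : 7 * H%:R ^+ 2 / n%:R <= p n by near: n.
have En : forall G : sgraph 'I_n, joined_graph H G -> E n G by near: n.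
have w0 (G : sgraph 'I_n) : 0 <= gnp_weight (p n) G by exact: gnp_weight_ge0.
apply/andP; split.
  apply: le_trans (gnp_prob_joined (p01 n) pn H_gt0 n_gt0) _.
  rewrite /gnp_prob [leRHS]big_mkcond [leLHS]big_mkcond; apply: ler_sum => G _.
  case: ifP => [/set_mem jG|_]; last by case: ifP.
  by rewrite (mem_set (En G jG)).
rewrite -(sum_gnp_weight n (p n)) /gnp_prob [leLHS]big_mkcond.
apply: ler_sum => G _.
by case: ifP.
Unshelve. all: by end_near. Qed.

(** * Even cycles in every coloring of a joined graph *)

Lemma natr_bound (R : realType) (x : R) : exists m : nat, x <= m%:R.
Proof.
exists (Num.truncn x).+1; have [x0|x0] := leP 0 x.
  by have /andP[_ /ltW] := truncn_itv x0.
by apply: le_trans (ltW x0) _; rewrite ler0n.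
Qed.

Section Deterministic.
Variables (R : realType) (r k0 : nat) (lambda beta eps : R).
Hypotheses (r_gt0 : (0 < r)%N) (lambda_gt0 : 0 < lambda) (beta_gt0 : 0 < beta).
Hypothesis eps_gt0 : 0 < eps.
Hypothesis path_arrows : forall k, (k0 <= k)%N -> forall G : sgraph 'I_k,
  (1 - eps) * 'C(k, 2)%:R <= #|edges G|%:R ->
  arrows r G (path_graph (Num.truncn (lambda * k%:R))).

Lemma joined_graph_even_cycles : exists2 H, (0 < H)%N &
  \forall n \near \oo%classic, forall G : sgraph 'I_n, joined_graph H G ->
  forall c : {set 'I_n} -> 'I_r, exists i, forall t, ~~ odd t ->
    (2 * trunc_log 2 n + 2 <= t)%N -> t%:R <= (lambda - beta) * n%:R ->
    mono_copy G c i (cycle_graph t).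
Proof.
(* [q1] keeps the missing pairs of the reduced graph below the fraction [eps], and [q2] the loss
   from leftover and holes below [beta n / 2]. [h1] makes one part smaller than that, [h2] makes the
   path of parts nonempty, and [2 * k0] forces at least [k0] parts. The [100] in [q] gives
   [50 * k <= s]. *)
have [q1 hq1] := natr_bound (4 / eps).
have [q2 hq2] := natr_bound (204 * lambda / beta).
have [h1 hh1] := natr_bound (2 / beta).
have [h2 hh2] := natr_bound (4 / lambda).
pose q := (100 + q1 + q2)%N; pose h := (2 * q + h1 + h2 + 2 * k0)%N.
have q_ge3 : (3 <= q)%N by rewrite /q; clear; lia.
have [q1q q2q] : (q1 <= q)%N /\ (q2 <= q)%N by rewrite /q; clear; lia.
have qh : (2 * q <= h)%N by rewrite /h; clear; lia.
have [h1h h2h k0h] : [/\ (h1 <= h)%N, (h2 <= h)%N & (2 * k0 <= h)%N].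
  by split; rewrite /h; clear; lia.
have [H hH] := regularity r_gt0 q_ge3 qh.
exists (H + 1)%N; first by rewrite addn1.
near=> n => G jG c.
have nH : (H <= n)%N by near: n; exact: nbhs_infty_ge.
(* Makes [s] larger than [q], so that [k] is at most [2s / q] despite rounding up. *)
have nHq : (H * q < n)%N by near: n; exact: nbhs_infty_gt.
have dense := dense_union_color c (leq_addr 1 H) jG.
have [|//|s [PP [[ePP s_gt0 hs Hs] [uq reg]]]] := hH _ (color_rel G c).
  by rewrite card_ord.
have covE := cardsC (finset.cover PP); rewrite (card_equipart s_gt0 ePP) in covE.
rewrite card_ord in hs Hs uq covE.
set K := #|PP| in covE reg *; set u := #|_| in uq covE.
pose k := (s %/ q).+1.
have q_gt0 : (0 < q)%N by exact: leq_trans q_ge3.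
have qs : (q <= s)%N.
  have : (H * q < H * s)%N by exact: leq_trans nHq Hs.
  by rewrite ltn_mul2l => /andP[_ /ltnW].
have kq : (q * k <= 2 * s)%N.
  by rewrite /k mulnS mulnC; have := leq_trunc_div s q; move: qs; clear; lia.
have k_gt0 : (0 < k)%N by [].
have large : (50 * k <= s)%N.
  have : (100 * k <= q * k)%N by rewrite leq_mul2r /q -addnA leq_addr orbT.
  by move: kq; clear; lia.
have n_gt0 : (0 < n)%N by exact: leq_ltn_trans nHq.
have Ks : (n <= 2 * (K * s))%N.
  have : (2 * (u * 100) <= 2 * (u * q))%N.
    by rewrite !leq_mul2l /q -addnA leq_addr !orbT.
  by move: uq covE; clear; lia.
have Kh : (h <= 2 * K)%N.
  have : (h * s <= 2 * K * s)%N by rewrite -mulnA; apply: leq_trans Ks.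
  by rewrite leq_pmul2r.
pose N := Num.truncn (lambda * K%:R : R).
have K0 : 0 <= lambda * K%:R by rewrite mulr_ge0 ?ler0n // ltW.
have /andP[NK KN] := truncn_itv K0; rewrite -/N in NK KN.
have N_gt0 : (0 < N)%N.
  rewrite truncn_gt0; have : 4 / lambda <= (2 * K)%:R.
    by apply: le_trans hh2 _; rewrite ler_nat; exact: leq_trans Kh.
  by rewrite ler_pdivrMr // natrM; lra.
have DA : arrows r (reduced_graph G c k PP) (path_graph N).
  apply: path_arrows.
    by have := leq_trans k0h Kh; rewrite leq_pmul2l.
  have := card_reduced_graph G c k PP; rewrite -(ler_nat R) natrD -/K.
  set bd := #|bad_pairs _ _ _|; set ed := #|edges _| => cRG.
  have : (bd * q)%:R <= (K ^ 2)%:R :> R by rewrite ler_nat.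
  have : (4 * 'C(K, 2))%:R >= (K ^ 2)%:R :> R.
    rewrite ler_nat bin2 -divn2.
    have : (2 <= K)%N by move: Kh qh q_ge3; clear; lia.
    have : ~~ odd (K * K.-1) by case: (K) => // m; rewrite oddM /=; case: odd.
    by clear; case: (K) => // m; rewrite /=; nia.
  have : 4 / eps <= q%:R by apply: le_trans hq1 _; rewrite ler_nat.
  rewrite ler_pdivrMr // !natrM => a1 a2 a3.
  have b0 : 0 <= bd%:R :> R by rewrite ler0n.
  suff : bd%:R <= eps * 'C(K, 2)%:R by move: cRG; lra.
  have q0 : 0 < q%:R :> R by rewrite ltr0n.
  have h4 : bd%:R * q%:R <= (q%:R * eps) * 'C(K, 2)%:R.
    by apply: le_trans a3 _; apply: le_trans a2 _; rewrite ler_wpM2r ?ler0n.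
  rewrite -(ler_pM2r q0); apply: le_trans h4 _.
  by rewrite le_eqVlt; apply/orP; left; apply/eqP; ring.
have [i hi] := reduced_arrows r_gt0 k_gt0 large ePP N_gt0 DA.
exists i => t ot tlow thigh; apply: hi => //; first by rewrite card_ord.
rewrite -(ler_nat R); apply: le_trans thigh _.
rewrite natrM natrB // natrM.
have q0 : 0 < q%:R :> R by rewrite ltr0n.
have h_gt0 : (0 < h)%N by apply: leq_trans qh; rewrite muln_gt0.
have h0 : 0 < h%:R :> R by rewrite ltr0n.
set S := s%:R; set k' := k%:R; set n' := n%:R.
have e1 : q%:R * k' <= 2 * S by rewrite -!natrM ler_nat.
have e2 : 2 * (u%:R * q%:R) <= 3 * n' by rewrite -!natrM ler_nat.
have e3 : K%:R * S + u%:R = n' by rewrite -natrM -natrD covE.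
have e4 : h%:R * S <= n' by rewrite -natrM ler_nat.
have S0 : 0 <= S by rewrite ler0n.
have u0 : 0 <= u%:R :> R by rewrite ler0n.
have k'0 : 0 <= k' by rewrite ler0n.
have n'0 : 0 <= n' by rewrite ler0n.
have e5 : 204 * lambda <= beta * q%:R.
  have : 204 * lambda / beta <= q%:R by apply: le_trans hq2 _; rewrite ler_nat.
  by rewrite ler_pdivrMr // (mulrC beta).
have e6 : 2 <= beta * h%:R.
  have : 2 / beta <= h%:R by apply: le_trans hh1 _; rewrite ler_nat.
  by rewrite ler_pdivrMr // (mulrC beta).
have e7 : 50 * k' <= S by rewrite -natrM ler_nat.
have e8 : lambda * K%:R - 1 <= N%:R by move: KN; rewrite -natr1; lra.
have f1 : (lambda * K%:R - 1) * (S - 50 * k') <= N%:R * (S - 50 * k').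
  by rewrite ler_wpM2r // subr_ge0.
apply: le_trans f1.
(* Rounding [lambda * K] down costs at most one part, bounded here; [f3] bounds the leftover and the
   [50k] lost per part. Each takes half of [beta]. *)
have f2 : S <= beta / 2 * n'.
  have : 2 * S <= beta * h%:R * S by rewrite ler_wpM2r.
  have : beta * (h%:R * S) <= beta * n' by rewrite ler_wpM2l // ltW.
  by lra.
have f3 : lambda * u%:R + lambda * (K%:R * (50 * k')) <= beta / 2 * n'.
  rewrite -(ler_pM2r q0).
  have g1 : lambda * (2 * (u%:R * q%:R)) <= lambda * (3 * n').
    by rewrite ler_wpM2l // ltW.
  have g2 : lambda * (K%:R * (q%:R * k')) <= lambda * (K%:R * (2 * S)).
    by rewrite !ler_wpM2l ?ler0n // ltW.
  have g3 : lambda * (K%:R * S) <= lambda * n'.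
    by rewrite ler_wpM2l ?(ltW lambda_gt0) // -e3 lerDl.
  have g4 : 204 * lambda * n' <= beta * q%:R * n' by rewrite ler_wpM2r.
  have g0 : 0 <= lambda * n' by rewrite mulr_ge0 // ltW.
  nra.
by move: f2 f3; rewrite -e3; nra.
Unshelve. all: by end_near. Qed.

End Deterministic.

(** * Logarithms and rounding of cycle lengths *)

Lemma half_le_ln2 (R : realType) : 2^-1 <= ln (2 : R).
Proof.
have : ln (1 + - 2^-1) <= - 2^-1 :> R by apply: le_ln1Dx; lra.
have -> : 1 + - 2^-1 = 2^-1 :> R by field.
by rewrite lnV ?posrE // lerN2.
Qed.

(** Source of the constant [8]: as [ln 2] is at least [1/2], both twice the binary logarithm and the
    summand [2] are at most [4 ln n]. *)
Lemma trunc_log_le_ln (R : realType) (n t : nat) : (1 < n)%N ->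
  8 * ln (n%:R : R) <= t%:R -> (2 * trunc_log 2 n + 2 <= t)%N.
Proof.
move=> n_gt1 hn; have h2 := half_le_ln2 R.
have n0 : 0 < n%:R :> R by rewrite ltr0n ltnW.
have ln2n : ln (2 : R) <= ln n%:R.
  by rewrite ler_ln ?posrE // ?ler_nat.
have hl : (trunc_log 2 n)%:R * ln (2 : R) <= ln n%:R.
  rewrite mulr_natl -lnXn // ler_ln ?posrE ?exprn_gt0 // -natrX ler_nat.
  by rewrite trunc_logP // ltnW.
rewrite -(ler_nat R) natrD natrM; have := ler0n R (trunc_log 2 n).
by nra.
Qed.

Lemma floor_evenP (R : realType) (x : R) : 0 <= x ->
  [/\ ~~ odd (floor_even x), (floor_even x)%:R <= x & x - 2 < (floor_even x)%:R].
Proof.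
move=> x0; have /andP[h1 h2] := truncn_itv x0.
set m := Num.truncn x in h1 h2.
have fE : floor_even x = (\max_(i < m.+1 | ~~ odd i) i)%N by [].
have [i oi iE] : {i : 'I_m.+1 | ~~ odd i & floor_even x = i}.
  by rewrite fE; apply: eq_bigmax_cond; apply/card_gt0P; exists ord0.
have mf : (m - odd m <= floor_even x)%N.
  have lt : (m - odd m < m.+1)%N by rewrite ltnS leq_subr.
  rewrite fE (leq_bigmax_cond (Ordinal lt)) //= oddB ?leq_b1 //.
    by case: odd.
  by case: (m) => //= m'; exact: leq_trans (leq_b1 _) _.
split.
- by rewrite iE.
- by apply: le_trans h1; rewrite ler_nat iE -ltnS.
have : (m.+1 <= floor_even x + 2)%N by move: mf; case: odd => /=; lia.
by rewrite -(ler_nat R) natrD; move: h2; lra.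
Qed.

(** Apply [ln y <= y] to [y = k n / 16]: half of [k n] bounds the logarithm, and the other half
    absorbs the constants. *)
Lemma ln_near_linear (R : realType) (k : R) : 0 < k ->
  \forall n \near \oo%classic, 8 * ln (n%:R : R) <= k * n%:R - 2.
Proof.
move=> k0; have a0 : 0 < k / 16 by rewrite divr_gt0.
have [m hm] := natr_bound ((2 - 8 * ln (k / 16)) * 2 / k).
near=> n.
have n_gt0 : (0 < n)%N by near: n; exact: nbhs_infty_gt.
have mn : (m <= n)%N by near: n; exact: nbhs_infty_ge.
have n0 : 0 < n%:R :> R by rewrite ltr0n.
have h1 : ln (k / 16 * n%:R) <= k / 16 * n%:R.
  have : ln (1 + (k / 16 * n%:R - 1)) <= k / 16 * n%:R - 1.
    by apply: le_ln1Dx; have := mulr_gt0 a0 n0; lra.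
  by rewrite addrC subrK; lra.
rewrite lnM ?posrE // in h1.
have h2 : (2 - 8 * ln (k / 16)) * 2 / k <= n%:R.
  by apply: le_trans hm _; rewrite ler_nat.
rewrite ler_pdivrMr // in h2.
by lra.
Unshelve. all: by end_near. Qed.

Theorem theorem7p4 (R : realType) (r : nat) (hr : (1 < r)%N) :
  exists A : R, 0 < A /\
    forall beta : R, 0 < beta ->
    exists C : R, 0 < C /\
      forall p : nat -> R,
        (forall n : nat, 0 <= p n <= 1) ->
        (\forall n \near \oo%classic, C / n%:R <= p n) ->
        gnp_whp p (fun n (G : sgraph 'I_n) =>
          arrows_family r G
            (even_cycles (A * ln n%:R) ((lambda_star R r - beta) * n%:R)))
        /\
        (beta < lambda_star R r ->
         gnp_whp p (fun n (G : sgraph 'I_n) =>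
           arrows r G
             (cycle_graph (floor_even ((lambda_star R r - beta) * n%:R))))).
Proof.
exists 8; split=> // beta beta_gt0; set ls := lambda_star R r.
have r_gt0 : (0 < r)%N by exact: ltnW.
(* If [ls <= beta], the upper end of the range is at most [0], below [8 ln n], so the family of
   cycles is empty. *)
have [hls|hls] := leP ls beta.
  exists (7 * 1%:R ^+ 2); split=> [|p p01 hp]; first by rewrite expr1n mulr1.
  split=> //.
  apply: (gnp_whp_of_joined (ltnSn 0) p01 hp); near=> n => G _ c.
  have n_gt1 : (1 < n)%N by near: n; exact: nbhs_infty_gt.
  exists (Ordinal r_gt0) => _ [t [ht1 ht2 _] ->]; exfalso.
  have : 0 < ln (n%:R : R) by rewrite ln_gt0 // ltr1n.
  have : (ls - beta) * n%:R <= 0.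
    by rewrite mulr_le0_ge0 ?ler0n // subr_le0.
  by move: ht1 ht2; lra.
have lsE : ls = lambda_star R r by [].
rewrite /lambda_star in lsE; set Lam := (X in sup X) in lsE.
(* Without a supremum [sup] is [0] by convention, against [beta < ls]. *)
have Lam_sup : has_sup Lam.
  by apply: contrapT => no; move: hls; rewrite lsE sup_out // ltNge ltW.
have beta2 : 0 < beta / 2 by rewrite divr_gt0.
(* Half of [beta] goes into approaching the supremum, the other half into the losses of the
   embedding. *)
have [lam [_ [eps eps0 [k0 hk0]]] hlam] := sup_adherent beta2 Lam_sup.
rewrite -lsE in hlam.
have lam_gt0 : 0 < lam by move: hls hlam; lra.
have [H H_gt0 hH] := joined_graph_even_cycles r_gt0 lam_gt0 beta2 eps0 hk0.
have {hH} core : \forall n \near \oo%classic, forall G : sgraph 'I_n,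
    joined_graph H G -> forall c : {set 'I_n} -> 'I_r, exists i, forall t,
    ~~ odd t -> 8 * ln (n%:R : R) <= t%:R -> t%:R <= (ls - beta) * n%:R ->
    mono_copy G c i (cycle_graph t).
  near=> n => G jG c.
  have n_gt1 : (1 < n)%N by near: n; exact: nbhs_infty_gt.
  have [|i hi] := (near hH n _) G jG c; first by [].
  exists i => t ot tlow thigh; apply: hi => //; first exact: trunc_log_le_ln tlow.
  by apply: le_trans thigh _; rewrite ler_wpM2r ?ler0n //; move: hlam; lra.
exists (7 * H%:R ^+ 2); split=> [|p p01 hp].
  by rewrite mulr_gt0 // exprn_gt0 // ltr0n.
split=> [|_]; apply: (gnp_whp_of_joined H_gt0 p01 hp); near=> n => G jG c.
  have [|i hi] := (near core n _) G jG c; first by [].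
  by exists i => _ [t [tlow thigh ot] ->]; exact: hi.
have [|i hi] := (near core n _) G jG c; first by [].
have x0 : 0 <= (ls - beta) * n%:R by rewrite mulr_ge0 ?ler0n // subr_ge0 ltW.
have [fo fle fge] := floor_evenP x0.
(* The rounded length exceeds [(ls - beta) n - 2], hence eventually [8 ln n], so it belongs to the
   range. *)
exists i; apply: hi => //; apply: le_trans (ltW fge); near: n.
by apply: ln_near_linear; rewrite subr_gt0.
Unshelve. all: by end_near. Qed.
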